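(* Consider the Semi-Lagrangian scheme (S) defined in the context, and assume that the displacement vectors satisfy (Y1) and that the interpolation operator $\mathcal I_{\Delta x}$ satisfies (I1) and (I2'). (a) Assume the coefficients $\sigma^{\alpha,\beta},b^{\alpha,\beta},c^{\alpha,\beta},f^{\alpha,\beta}$ are bounded uniformly in $\alpha,\beta$. Then (S) is consistent with equation (E): there is a constant $C$, independent of $\phi,\Delta t,\Delta x,k$, such that for every smooth function $\phi$ (with bounded derivatives) the truncation error of (S), as defined in the context, is bounded by $$\frac{|1-2\theta|}{2}|\phi_{tt}|_0\Delta t+C\Big(\Delta t^2\big(|\phi_{tt}|_0+|\phi_{ttt}|_0+|D\phi_{tt}|_0+|D^2\phi_{tt}|_0\big)+|D^r\phi|_0\frac{\Delta x^r}{k^2}+(|D\phi|_0+\dots+|D^4\phi|_0)k^2\Big).$$ (b) The scheme (S) is of class $\tilde L$ (defined in the context) if the following CFL condition holds for all $\alpha,\beta,n,i$: $$(1-\theta)\Delta t\Big[\frac{M}{k^2}-c^{\alpha,\beta}(t_{n-1}+\theta\Delta t_n,x_i)\Big]\le 1\quad\text{and}\quad \theta\Delta t\,c^{\alpha,\beta}(t_{n-1}+\theta\Delta t_n,x_i)\le 1. \tag{CFL}$$ (c) If in addition (A1) and (CFL) hold and $2\theta\Delta t\sup_{\alpha,\beta}|c^{\alpha,\beta,+}|_0\le 1$, where $c^{\alpha,\beta,+}$ is the positive part of $c^{\alpha,\beta}$, then any bounded solution $U$ of (S) with initial condition $U_i^0=g(x_i)$ is $L^\infty$-stable, satisfying $$|U^n|_0\le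 e^{2\sup_{\alpha,\beta}|c^{\alpha,\beta,+}|_0t_n}\Big[|g|_0+t_n\sup_{\alpha,\beta}|f^{\alpha,\beta}|_0\Big],$$ where $|U^n|_0=\sup_i|U^n_i|$.
   Context: Equation. Let $T>0$, $Q_T=(0,T]\times\mathbb R^N$, and let $\mathcal A,\mathcal B$ be complete metric spaces. Equation (E) is $$u_t-\inf_{\alpha\in\mathcal A}\sup_{\beta\in\mathcal B}\big\{L^{\alpha,\beta}[u](t,x)+c^{\alpha,\beta}(t,x)u+f^{\alpha,\beta}(t,x)\big\}=0\ \text{ in }Q_T,\qquad L^{\alpha,\beta}[u]=\mathrm{tr}[a^{\alpha,\beta}D^2u]+b^{\alpha,\beta}\cdot Du,$$ with initial condition $u(0,x)=g(x)$, where $a^{\alpha,\beta}=\frac12\sigma^{\alpha,\beta}\sigma^{\alpha,\beta\,\top}$, and $\sigma^{\alpha,\beta},b^{\alpha,\beta},c^{\alpha,\beta},f^{\alpha,\beta}$ are defined on $[0,T]\times\mathbb R^N$ with values in $\mathbb R^{N\times P},\mathbb R^N,\mathbb R,\mathbb R$. Norms. $|w|_0$ is the supremum of $|w|$ over its domain (Euclidean/Frobenius norm), $[w]_1=\sup_{(t,x)\ne(s,y)}\frac{|w(t,x)-w(s,y)|}{|x-y|+|t-s|^{1/2}}$, $|w|_1=|w|_0+[w]_1$ (for functions of $x$ only the $t$-part is dropped). (A1): there is a constant $K$ independent of $\alpha,\beta$ with $|g|_1+|\sigma^{\alpha,\beta}|_1+|b^{\alpha,\beta}|_1+|c^{\alpha,\beta}|_1+|f^{\alpha,\beta}|_1\le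 K$. Grid. $0=t_0<t_1<\dots$, $\Delta t_n=t_n-t_{n-1}\le\Delta t$ (only times in $[0,T]$ are used); $X_{\Delta x}=\{x_i\}_{i\in\mathbb N}$ is the set of vertices of a polyhedral subdivision $\{T_j\}_j$ of $\mathbb R^N$ (cells with disjoint interiors covering $\mathbb R^N$) with $\rho\Delta x\le\sup_j\mathrm{diam}\,B_{T_j}\le\sup_j\mathrm{diam}\,T_j\le\Delta x$ for a fixed $\rho\in(0,1)$, $B_{T_j}$ the greatest ball contained in $T_j$. $G=\{t_n\}\times X_{\Delta x}$. Difference operator. For $k\in(0,1]$ and a fixed integer $M\ge1$, given vectors $y^{\alpha,\beta,\pm}_{k,i}(t,x)\in\mathbb R^N$, $i=1,\dots,M$, $$L_k^{\alpha,\beta}[\phi](t,x)=\sum_{i=1}^M\frac{\phi(t,x+y^{\alpha,\beta,+}_{k,i}(t,x))-2\phi(t,x)+\phi(t,x+y^{\alpha,\beta,-}_{k,i}(t,x))}{2k^2}.$$ (Y1): with $y^\pm_i=y^{\alpha,\beta,\pm}_{k,i}$ and all $j_1,\dots,j_4\in\{1,\dots,N\}$ denoting components, $\sum_i[y^+_i+y^-_i]=2k^2b^{\alpha,\beta}+\mathcal O(k^4)$; $\sum_i[y^+_iy^{+\top}_i+y^-_iy^{-\top}_i]=2k^2\sigma^{\alpha,\beta}\sigma^{\alpha,\beta\,\top}+\mathcal O(k^4)$; $\sum_i[y^+_{i,j_1}y^+_{i,j_2}y^+_{i,j_3}+y^-_{i,j_1}y^-_{i,j_2}y^-_{i,j_3}]=\mathcal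 O(k^4)$; $\sum_i[y^+_{i,j_1}y^+_{i,j_2}y^+_{i,j_3}y^+_{i,j_4}+y^-_{i,j_1}y^-_{i,j_2}y^-_{i,j_3}y^-_{i,j_4}]=\mathcal O(k^4)$; the $\mathcal O(k^4)$ being uniform in $\alpha,\beta,t,x$ and $k\in(0,1]$. Interpolation $\mathcal I_{\Delta x}$ maps functions on $X_{\Delta x}$ (or restrictions of functions on $\mathbb R^N$ to $X_{\Delta x}$) to functions on $\mathbb R^N$. (I1): there are $K\ge0$, $r\in\mathbb N$ (independent of $\Delta x$) such that $|\mathcal I_{\Delta x}\phi-\phi|_0\le K|D^r\phi|_0\Delta x^r$ for all smooth $\phi$. (I2'): for each $\phi$ there are functions $w_{\phi,j}\ge0$ on $\mathbb R^N$ with $(\mathcal I_{\Delta x}\phi)(x)=\sum_j\phi(x_j)w_{\phi,j}(x)$, $w_{\phi,i}(x_j)=\delta_{ij}$, and $\sum_iw_{\phi,i}(x)\equiv1$. Scheme (S). For $\theta\in[0,1]$, writing $\psi^{n-1+\theta}_i=\psi(t_{n-1}+\theta\Delta t_n,x_i)$ for the coefficients, $\delta_{\Delta t_n}U^n_i=(U^n_i-U^{n-1}_i)/\Delta t_n$, $\overline U^{\theta,n}=(1-\theta)U^{n-1}+\theta U^n$, $\overline{\mathcal I_{\Delta x}U}^{\theta,n}=(1-\theta)\mathcal I_{\Delta x}U^{n-1}+\theta\mathcal I_{\Delta x}U^n$, $$\delta_{\Delta t_n}U^n_i=\inf_{\alpha\in\mathcal A}\sup_{\beta\in\mathcal B}\Big\{L_k^{\alpha,\beta}[\overline{\mathcal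 I_{\Delta x}U}^{\theta,n}]^{n-1+\theta}_i+c^{\alpha,\beta,n-1+\theta}_i\overline U^{\theta,n}_i+f^{\alpha,\beta,n-1+\theta}_i\Big\}\quad\text{in }G,\ n\ge1,$$ where $L_k^{\alpha,\beta}[\cdot]_i^{n-1+\theta}$ means that the displacement vectors are evaluated at $(t_{n-1}+\theta\Delta t_n,x_i)$. Truncation error: for smooth $\phi$, the supremum over $n,i$ of the absolute value of $$\delta_{\Delta t_n}\phi^n_i-\inf_\alpha\sup_\beta\{L_k^{\alpha,\beta}[\overline{\mathcal I_{\Delta x}\phi}^{\theta,n}]^{n-1+\theta}_i+c^{\alpha,\beta,n-1+\theta}_i\overline\phi^{\theta,n}_i+f^{\alpha,\beta,n-1+\theta}_i\}$$ minus $\big(\phi_t-\inf_\alpha\sup_\beta\{L^{\alpha,\beta}[\phi]+c^{\alpha,\beta}\phi+f^{\alpha,\beta}\}\big)(t_{n-1}+\theta\Delta t_n,x_i)$, where $\phi^n_i=\phi(t_n,x_i)$. Class $\tilde L$: (S) is of class $\tilde L$ if it can be written, at every $(t_n,x_j)\in G$, $n\ge1$, as $$\sup_\alpha\inf_\beta\Big\{B^{\alpha,\beta,n,n}_{U^n,j,j}U^n_j-\sum_{i\ne j}B^{\alpha,\beta,n,n}_{U^n,j,i}U^n_i-\sum_iB^{\alpha,\beta,n,n-1}_{U^{n-1},j,i}U^{n-1}_i-F^{\alpha,\beta,n}_j\Big\}=0$$ with all coefficients $B^{\alpha,\beta,n,m}_{U^m,j,i}\ge0$ (possibly depending on $U^m$).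 *)

(* Defs.v *)
From HB Require Import structures.
From mathcomp Require Import all_boot all_order all_algebra.
From mathcomp Require Import all_classical all_reals all_analysis.

Set Implicit Arguments.
Unset Strict Implicit.
Unset Printing Implicit Defensive.

Import Order.TTheory GRing.Theory Num.Theory.
Import numFieldNormedType.Exports.

Local Open Scope classical_set_scope.
Local Open Scope ring_scope.

(* The library's complete spaces are pointed, hence the control sets are
   nonempty. *)
#[short(type="completeMetricType")]
HB.structure Definition CompleteMetric (K : numDomainType) :=
  {M of Complete M & Metric K M}.

(* Space-time points are pairs [(t, x)]; suprema and infima are taken in the
   extended reals, so that no finiteness is presupposed. *)

Section Norms.
Context {R : realType}.

(* Frobenius norm; Euclidean norm on row vectors.  The library's norm on
   matrices is the maximum norm. *)
Definition enorm m n (A : 'M[R]_(m, n)) : R :=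
  Num.sqrt (\sum_i \sum_j A i j ^+ 2).

Definition norm0 (Z : Type) (V : Type) (nrm : V -> R) (D : set Z)
    (w : Z -> V) : \bar R :=
  ereal_sup [set (nrm (w z))%:E | z in D].

Definition seminorm1 (Z : Type) (V : zmodType) (dist : Z -> Z -> R)
    (nrm : V -> R) (D : set Z) (w : Z -> V) : \bar R :=
  ereal_sup [set (nrm (w p.1 - w p.2) / dist p.1 p.2)%:E |
             p in [set p : Z * Z | [/\ D p.1, D p.2 & p.1 <> p.2]]].

Definition norm1 (Z : Type) (V : zmodType) (dist : Z -> Z -> R)
    (nrm : V -> R) (D : set Z) (w : Z -> V) : \bar R :=
  (norm0 nrm D w + seminorm1 dist nrm D w)%E.

Definition space_dist N (x y : 'rV[R]_N) : R := enorm (x - y).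

Definition parabolic_dist N (z z' : R * 'rV[R]_N) : R :=
  space_dist z.2 z'.2 + Num.sqrt `|z.1 - z'.1|.

Definition slab (N : nat) (T : R) : set (R * 'rV[R]_N) :=
  [set z | 0 <= z.1 <= T].

End Norms.

Section Smooth.
Context {R : realType}.

Definition iterD (V : normedModType R) (s : seq V) (f : V -> R) : V -> R :=
  foldr (fun v g => 'D_v (g : V -> R^o)) f s.

(* In finite dimension this is C^oo: every iterated directional derivative is
   Frechet differentiable, hence continuous. *)
Definition smooth (V : normedModType R) (f : V -> R) : Prop :=
  forall (s : seq V) (z : V), differentiable (iterD s f : V -> R^o) z.

(* Euclidean norm of the tensor of all [m]-th order derivatives along the
   directions [e j]. *)
Definition Dnorm (V : normedModType R) N (e : 'I_N -> V) (m : nat)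
    (f : V -> R) (z : V) : R :=
  Num.sqrt (\sum_(s : m.-tuple 'I_N) iterD (map e s) f z ^+ 2).

Definition dir N (j : 'I_N) : 'rV[R]_N := delta_mx 0 j.
Definition dir_x N (j : 'I_N) : (R * 'rV[R]_N)%type := (0, dir j).
Definition dir_t N : (R * 'rV[R]_N)%type := (1, 0).

Definition Dt N (m : nat) (phi : R * 'rV[R]_N -> R) : R * 'rV[R]_N -> R :=
  iterD (nseq m (dir_t N)) phi.

(* [|D^m phi|_0] on the closed strip [0,T] x R^N, D being the derivative
   in x. *)
Definition sup_Dx N (T : R) (m : nat) (phi : R * 'rV[R]_N -> R) : \bar R :=
  norm0 Num.norm (slab T) (Dnorm (@dir_x N) m phi).

Definition bounded_derivatives N (T : R) (phi : R * 'rV[R]_N -> R) : Prop :=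
  forall s : seq (R * 'rV[R]_N),
    s <> [::] -> (norm0 Num.norm (slab T) (iterD s phi) < +oo)%E.

End Smooth.

Section Mesh.
Context {R : realType} {N : nat}.
Implicit Types (P S : set 'rV[R]_N).

Definition polytope P : Prop :=
  exists (m : nat) (p : 'I_m -> 'rV[R]_N),
    P = [set v | exists w : 'I_m -> R,
          [/\ forall i, 0 <= w i, \sum_i w i = 1 & v = \sum_i w i *: p i]].

Definition extreme_points P : set 'rV[R]_N :=
  [set v | P v /\ forall a b (s : R), P a -> P b -> 0 < s < 1 ->
             v = s *: a + (1 - s) *: b -> a = v /\ b = v].

Definition diam S : \bar R :=
  ereal_sup [set (space_dist p.1 p.2)%:E |
             p in [set p : 'rV[R]_N * 'rV[R]_N | S p.1 /\ S p.2]].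

Definition eball (c : 'rV[R]_N) (r : R) : set 'rV[R]_N :=
  [set v | space_dist v c <= r].

Definition greatest_ball P S : Prop :=
  exists c r, [/\ 0 < r, S = eball c r, S `<=` P &
    forall c' r', eball c' r' `<=` P -> r' <= r].

(* [cell] is the subdivision, [inball j] the ball B_{T_j}, and [x] an
   enumeration without repetition of the vertices.  The bound on the diameters
   makes all cells bounded, and there are then countably infinitely many of
   them, so both families are indexed by [nat]. *)
Definition mesh_of_size (rho dx : R) (cell inball : nat -> set 'rV[R]_N)
    (x : nat -> 'rV[R]_N) : Prop :=
  [/\ forall j, polytope (cell j) /\ (cell j)° !=set0,
      \bigcup_j cell j = setT,
      forall i j, i <> j -> (cell i)° `&` (cell j)° = set0,
      injective x /\ range x = \bigcup_j extreme_points (cell j) &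
      [/\ forall j, greatest_ball (cell j) (inball j),
          ((rho * dx)%:E <= ereal_sup [set diam (inball j) | j in setT])%E,
          (ereal_sup [set diam (inball j) | j in setT] <=
           ereal_sup [set diam (cell j) | j in setT])%E &
          (ereal_sup [set diam (cell j) | j in setT] <= dx%:E)%E]].

Definition time_grid (dt : R) (t : nat -> R) : Prop :=
  [/\ t 0%N = 0, forall n, t n < t n.+1 & forall n, t n.+1 - t n <= dt].

End Mesh.

(* A grid function on X_{dx} is a function of the index of the vertex; an
   interpolation operator [I] acts on grid functions, and on functions on R^N
   through their restriction to the vertices.  The first argument of [x] and
   [I] is dx. *)
Section Interpolation.
Context {R : realType} {N : nat}.
Implicit Types (x : R -> nat -> 'rV[R]_N)
  (I : R -> (nat -> R) -> 'rV[R]_N -> R).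

Definition I1 x I (K : R) (r : nat) : Prop :=
  0 <= K /\
  forall (dx : R) (phi : 'rV[R]_N -> R), 0 < dx -> smooth phi ->
    (norm0 Num.norm setT (Dnorm (@dir R N) r phi) < +oo)%E ->
    (norm0 Num.norm setT (fun y => I dx (phi \o x dx) y - phi y)%R <=
     K%:E * norm0 Num.norm setT (Dnorm (@dir R N) r phi) * (dx ^+ r)%:E)%E.

Definition I2' x I : Prop :=
  forall (dx : R), 0 < dx -> forall phi : nat -> R,
  exists w : nat -> 'rV[R]_N -> R,
    [/\ forall j y, 0 <= w j y,
        forall y, series (fun j => phi j * w j y) @ \oo --> I dx phi y,
        forall i j, w i (x dx j) = (i == j)%:R &
        forall y, series (fun i => w i y) @ \oo --> (1 : R)].

End Interpolation.

Section InfSup.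
Context {R : realType} {A B : Type}.

Definition inf_sup (H : A -> B -> R) : \bar R :=
  ereal_inf [set ereal_sup [set (H a b)%:E | b in setT] | a in setT].

Definition sup_inf (H : A -> B -> R) : \bar R :=
  ereal_sup [set ereal_inf [set (H a b)%:E | b in setT] | a in setT].

Definition sup_AB (H : A -> B -> \bar R) : \bar R :=
  ereal_sup [set H ab.1 ab.2 | ab in setT].

End InfSup.

Section Equation.
Context {R : realType} (N P : nat) (A B : Type).

Record coefficients := Coefficients {
  sigma : A -> B -> R * 'rV[R]_N -> 'M[R]_(N, P);
  drift : A -> B -> R * 'rV[R]_N -> 'rV[R]_N;
  zeroth : A -> B -> R * 'rV[R]_N -> R;
  source : A -> B -> R * 'rV[R]_N -> R }.

Definition grad (phi : R * 'rV[R]_N -> R) z : 'rV[R]_N :=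
  \row_j iterD [:: dir_x j] phi z.

Definition hess (phi : R * 'rV[R]_N -> R) z : 'M[R]_N :=
  \matrix_(i, j) iterD [:: dir_x i; dir_x j] phi z.

Variable E : coefficients.

Definition diffusion a b z : 'M[R]_N :=
  2^-1 *: (sigma E a b z *m (sigma E a b z)^T).

Definition Lop a b (phi : R * 'rV[R]_N -> R) z : R :=
  \tr (diffusion a b z *m hess phi z)
  + \sum_j drift E a b z 0 j * grad phi z 0 j.

Definition pde_rhs (phi : R * 'rV[R]_N -> R) z : \bar R :=
  inf_sup (fun a b => Lop a b phi z + zeroth E a b z * phi z + source E a b z).

Definition bounded_coefficients (T : R) : Prop :=
  exists K : R, forall a b,
    (norm0 (@enorm R N P) (slab T) (sigma E a b)
     + norm0 (@enorm R 1 N) (slab T) (drift E a b)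
     + norm0 Num.norm (slab T) (zeroth E a b)
     + norm0 Num.norm (slab T) (source E a b) <= K%:E)%E.

Definition A1 (T : R) (g : 'rV[R]_N -> R) : Prop :=
  exists K : R, forall a b,
    (norm1 (@space_dist R N) Num.norm setT g
     + norm1 (@parabolic_dist R N) (@enorm R N P) (slab T) (sigma E a b)
     + norm1 (@parabolic_dist R N) (@enorm R 1 N) (slab T) (drift E a b)
     + norm1 (@parabolic_dist R N) Num.norm (slab T) (zeroth E a b)
     + norm1 (@parabolic_dist R N) Num.norm (slab T) (source E a b) <= K%:E)%E.

Definition sup_zeroth_pos (T : R) : \bar R :=
  sup_AB (fun a b => norm0 Num.norm (slab T)
                       (fun z => Num.max (zeroth E a b z) 0)).

Definition sup_source (T : R) : \bar R :=
  sup_AB (fun a b => norm0 Num.norm (slab T) (source E a b)).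

Section Scheme.
Variable M : nat.

Record displacements := Displacements {
  yplus : R -> A -> B -> 'I_M -> R * 'rV[R]_N -> 'rV[R]_N;
  yminus : R -> A -> B -> 'I_M -> R * 'rV[R]_N -> 'rV[R]_N }.

Variable Y : displacements.

Definition Y1 (T : R) : Prop :=
  exists K : R, forall (k : R) a b z, 0 < k <= 1 -> slab T z ->
    let yp i := yplus Y k a b i z in
    let ym i := yminus Y k a b i z in
    [/\ enorm (\sum_i (yp i + ym i) - (2 * k ^+ 2) *: drift E a b z)
          <= K * k ^+ 4,
        enorm (\sum_i ((yp i)^T *m yp i + (ym i)^T *m ym i)
               - (2 * k ^+ 2) *: (sigma E a b z *m (sigma E a b z)^T))
          <= K * k ^+ 4,
        forall j1 j2 j3,
          `|\sum_i (yp i 0 j1 * yp i 0 j2 * yp i 0 j3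
                    + ym i 0 j1 * ym i 0 j2 * ym i 0 j3)| <= K * k ^+ 4 &
        forall j1 j2 j3 j4,
          `|\sum_i (yp i 0 j1 * yp i 0 j2 * yp i 0 j3 * yp i 0 j4
                    + ym i 0 j1 * ym i 0 j2 * ym i 0 j3 * ym i 0 j4)|
          <= K * k ^+ 4].

(* The function [psi] is the time slice to which the operator is applied; [z]
   is the point at which the displacement vectors are evaluated. *)
Definition Lk (k : R) a b (psi : 'rV[R]_N -> R) (z : R * 'rV[R]_N) : R :=
  \sum_i (psi (z.2 + yplus Y k a b i z) - 2 * psi z.2
          + psi (z.2 + yminus Y k a b i z)) / (2 * k ^+ 2).

Variables (theta k : R) (t : nat -> R) (x : nat -> 'rV[R]_N).

Definition tau (n : nat) : R := t n.-1 + theta * (t n - t n.-1).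

Definition delta_t (U : nat -> nat -> R) n i : R :=
  (U n i - U n.-1 i) / (t n - t n.-1).

Variable I : (nat -> R) -> 'rV[R]_N -> R.

Definition scheme_rhs (U : nat -> nat -> R) n i : \bar R :=
  let z := (tau n, x i) in
  inf_sup (fun a b =>
    Lk k a b (fun y => (1 - theta) * I (U n.-1) y + theta * I (U n) y) z
    + zeroth E a b z * ((1 - theta) * U n.-1 i + theta * U n i)
    + source E a b z).

Definition scheme_eq (U : nat -> nat -> R) n i : Prop :=
  (delta_t U n i)%:E = scheme_rhs U n i.

Definition grid_restr (phi : R * 'rV[R]_N -> R) : nat -> nat -> R :=
  fun n i => phi (t n, x i).

Definition truncation_error (T : R) (phi : R * 'rV[R]_N -> R) : \bar R :=
  ereal_sup [set
    (let z := (tau ni.1, x ni.2) in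
     `| ((delta_t (grid_restr phi) ni.1 ni.2)%:E
         - scheme_rhs (grid_restr phi) ni.1 ni.2)
        - ((Dt 1 phi z)%:E - pde_rhs phi z) |)%E
    | ni in [set ni : nat * nat | (0 < ni.1)%N /\ t ni.1 <= T]].

Definition CFL (T dt : R) : Prop :=
  forall a b n i, (0 < n)%N -> t n <= T ->
    (1 - theta) * dt * (M%:R / k ^+ 2 - zeroth E a b (tau n, x i)) <= 1 /\
    theta * dt * zeroth E a b (tau n, x i) <= 1.

End Scheme.

End Equation.

(* [C a b n m V j i] is the coefficient B^{a,b,n,m}_{V,j,i}.  The sums over
   the vertices are series in the order of the enumeration and are required to
   converge. *)
Definition class_Ltilde {R : realType} (A B : Type) (T : R) (t : nat -> R)
    (eqn : (nat -> nat -> R) -> nat -> nat -> Prop) : Prop :=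
  exists (C : A -> B -> nat -> nat -> (nat -> R) -> nat -> nat -> R)
         (F : A -> B -> nat -> nat -> R),
  forall n j, (0 < n)%N -> t n <= T ->
    (forall a b V i, 0 <= C a b n n V j i /\ 0 <= C a b n n.-1 V j i) /\
    forall U : nat -> nat -> R,
      let implicit a b i :=
        if i == j then 0 else C a b n n (U n) j i * U n i in
      let explicit a b i := C a b n n.-1 (U n.-1) j i * U n.-1 i in
      (forall a b, cvgn (series (implicit a b)) /\
                   cvgn (series (explicit a b))) /\
      (eqn U n j <->
       sup_inf (fun a b =>
         C a b n n (U n) j j * U n j - limn (series (implicit a b))
         - limn (series (explicit a b)) - F a b n j) = 0%E).

(* Main.v *)
From HB Require Import structures.
Require Import Defs.
From mathcomp Require Import all_boot all_order all_algebra.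
From mathcomp Require Import all_classical all_reals all_analysis.
From mathcomp Require Import ring lra.

(** The semi-Lagrangian operator [Lk] is a weighted sum of increments of its
    argument, so everything rests on the interpolation being an average with
    nonnegative weights of total mass one ([interp_weights]) which reproduces
    grid values at the vertices ([interp_node]).

    Class L tilde.  Inserting the weights, [Lk] applied to the interpolant of
    [V] at a vertex [x_j] becomes a nonnegative combination of the values of
    [V], of total mass [M / k ^+ 2], minus [M / k ^+ 2 * V j].  Sorting the
    scheme by the unknowns [U n i] and [U n.-1 i], the off-diagonal
    coefficients have the right sign, and the two CFL inequalities are what
    makes the two diagonal ones nonnegative, all weights being at most one
    ([scheme_class_Ltilde]).

    Stability.  The same form yields a maximum principle.  If [m] and [m']
    bound [|U n|] and [|U n.-1|], then selecting a nearly optimal control gives, at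
    each vertex, an inequality in which the neighbours contribute
    [theta * (M / k ^+ 2) * m] ([scheme_pointwise_bound]).  For [m] the supremum
    of [|U n|] this contribution cancels against the diagonal, leaving
    [m * (1 - theta * h * c) <= (1 + (1 - theta) * h * c) * m' + h * F], with
    [h] the time step and [c], [F] the bounds on the zeroth order coefficient
    and on the source ([scheme_step_bound]).  The bound on the step gives
    [1 / (1 - p) <= 1 + 2 * p <= exp (2 * p)] for [p = theta * h * c], and
    induction on [n] produces the exponential ([scheme_stable]).

    Consistency.  Both the scheme and the equation are an inf sup over the same
    controls, and inf sup is 1-Lipschitz for the uniform distance
    ([inf_sup_dist]); it is enough to compare the expressions under inf sup
    with constants uniform in the controls ([hamiltonian_consistency]).  Their
    difference has three sources.  Interpolation costs [dx ^+ r] at each of the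
    [O(M)] points used by [Lk], divided by [k ^+ 2].  A fourth-order Taylor
    expansion along the displacements, whose moments match those of the
    diffusion to order [k ^+ 4], costs [k ^+ 2] ([moment_expansion],
    [space_consistency]); the fourth moments enter only through the size of the
    displacements, which they force to be [O(k)].  The [theta]-average in time
    replaces the value at the intermediate time up to the square of the step
    ([time_average_error]); applied to the space derivatives of [phi] it asks
    for [D_t D_t D_x phi], which is rewritten as [D_x D_t D_t phi] by symmetry
    of mixed derivatives ([iterD_perm]).  Outside inf sup, the difference quotient in
    time has the leading error [(1 - 2 * theta) / 2 * h * phi_tt]
    ([time_difference_error]).

    Taylor bounds are only needed up to constants, which allows an elementary
    proof by iterating the mean value theorem ([taylor_line]). *)

Set Implicit Arguments.
Unset Strict Implicit.
Unset Printing Implicit Defensive.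

Import Order.TTheory GRing.Theory Num.Theory.
Import numFieldNormedType.Exports.

Local Open Scope classical_set_scope.
Local Open Scope ring_scope.

(* [iterD] is also the name of a lemma on [iter]. *)
Local Notation iterD := Defs.iterD.

(** * Directional derivatives and Taylor expansion *)

Section DirectionalDerivatives.
Context {R : realType} {V : normedModType R}.
Implicit Types (f g : V -> R) (z u v : V).

Lemma iterD_cat s1 s2 f : iterD (s1 ++ s2) f = iterD s1 (iterD s2 f).
Proof. by rewrite /iterD foldr_cat. Qed.

Lemma iterD_cons v s f : iterD (v :: s) f = iterD [:: v] (iterD s f).
Proof. by []. Qed.

Lemma smooth_iterD s f : smooth f -> smooth (iterD s f).
Proof. by move=> sf s' z; rewrite -iterD_cat; exact: sf. Qed.

Lemma smooth_derivable f z v : smooth f -> derivable (f : V -> R^o) z v.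
Proof. by move=> sf; apply: diff_derivable; exact: (sf [::] z). Qed.

Arguments smooth_derivable [f] z v _.

Lemma smooth_continuous f : smooth f -> continuous (f : V -> R^o).
Proof. by move=> sf z; apply: differentiable_continuous; exact: (sf [::] z). Qed.

Lemma iterD1D f g v : smooth f -> smooth g ->
  iterD [:: v] (fun z => f z + g z) = (fun z => iterD [:: v] f z + iterD [:: v] g z).
Proof.
move=> sf sg; apply/funext => z /=.
have H := @deriveD _ _ R^o f g _ _ (smooth_derivable z v sf) (smooth_derivable z v sg).
exact: H.
Qed.

Lemma iterD1Z f v (c : R) : smooth f ->
  iterD [:: v] (fun z => c * f z) = (fun z => c * iterD [:: v] f z).
Proof.
move=> sf; apply/funext => z /=.
exact: (@deriveZ _ _ R^o f c _ _ (smooth_derivable z v sf)).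
Qed.

Lemma iterDD s f g : smooth f -> smooth g ->
  iterD s (fun z => f z + g z) = (fun z => iterD s f z + iterD s g z).
Proof.
move=> sf sg; elim: s => //= v s IH.
rewrite -[LHS]/(iterD [:: v] (iterD s (fun z => f z + g z))) IH.
by rewrite iterD1D //; exact: smooth_iterD.
Qed.

Lemma iterDZ s f (c : R) : smooth f ->
  iterD s (fun z => c * f z) = (fun z => c * iterD s f z).
Proof.
move=> sf; elim: s => //= v s IH.
rewrite -[LHS]/(iterD [:: v] (iterD s (fun z => c * f z))) IH.
by rewrite iterD1Z //; exact: smooth_iterD.
Qed.

Lemma smoothD f g : smooth f -> smooth g -> smooth (fun z => f z + g z).
Proof.
move=> sf sg s z; rewrite iterDD //.
exact: (@differentiableD _ _ R^o _ _ _ (sf s z) (sg s z)).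
Qed.

Lemma smoothZ f (c : R) : smooth f -> smooth (fun z => c * f z).
Proof.
move=> sf s z; rewrite iterDZ //.
exact: (@differentiableZ _ _ R^o _ c _ (sf s z)).
Qed.

Lemma smooth_cst (c : R) : smooth (fun _ : V => c).
Proof.
move=> s.
suff [c' ->] : exists c', iterD s (fun _ : V => c) = (fun _ => c').
  by move=> z; exact: (@differentiable_cst _ _ R^o).
elim: s => [|v s [c' /= IH]]; first by exists c.
by exists 0; apply/funext => z /=; rewrite IH; exact: (@derive_cst _ _ R^o).
Qed.

Lemma iterD_sum (J : finType) (F : J -> V -> R) s : (forall j, smooth (F j)) ->
  iterD s (fun z => \sum_j F j z) = (fun z => \sum_j iterD s (F j) z).
Proof.
move=> sF.
suff H : forall r : seq J, smooth (fun z => \sum_(j <- r) F j z) /\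
   iterD s (fun z => \sum_(j <- r) F j z) = (fun z => \sum_(j <- r) iterD s (F j) z).
  by have [] := H (index_enum J).
elim=> [|j r [sr IH]].
  have e0 : (fun z => \sum_(j <- [::]) F j z) = (fun _ : V => 0 * 0).
    by apply/funext => z; rewrite big_nil mul0r.
  rewrite e0; split; first exact: smooth_cst.
  rewrite (iterDZ s 0 (smooth_cst 0)); apply/funext => z.
  by rewrite big_nil mul0r.
have ej : (fun z => \sum_(i <- j :: r) F i z) =
          (fun z => F j z + \sum_(i <- r) F i z).
  by apply/funext => z; rewrite big_cons.
rewrite ej; split; first exact: smoothD.
by rewrite iterDD // IH; apply/funext => z; rewrite big_cons.
Qed.

(** Linearity in the direction is where Frechet differentiability enters:
    existence of all directional derivatives would not give it. *)
Lemma iterD1_sum (J : finType) (y : J -> R) (e : J -> V) f : smooth f ->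
  iterD [:: \sum_j y j *: e j] f = (fun z => \sum_j y j * iterD [:: e j] f z).
Proof.
move=> sf; apply/funext => z /=.
rewrite deriveE; last exact: (sf [::]).
rewrite linear_sum; apply: eq_bigr => j _.
by rewrite linearZ deriveE; last exact: (sf [::]).
Qed.

Lemma iterD_multilinear (J : finType) (y : J -> R) (e : J -> V) s1 s2 f z :
  smooth f ->
  iterD (s1 ++ (\sum_j y j *: e j) :: s2) f z =
  \sum_j y j * iterD (s1 ++ e j :: s2) f z.
Proof.
move=> sf; rewrite iterD_cat iterD_cons iterD1_sum; last exact: smooth_iterD.
rewrite iterD_sum; last by move=> j; apply: smoothZ; apply: smooth_iterD; exact: smooth_iterD.
apply: eq_bigr => j _; rewrite iterDZ; last by apply: smooth_iterD; exact: smooth_iterD.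
by rewrite iterD_cat.
Qed.

(** Needed for translations and for the time slices [phi (s, _)]. *)
Lemma iterD_affine (W : normedModType R) (L : {linear W -> V}) p s f :
  iterD s (fun y : W => f (p + L y)) = (fun y => iterD (map L s) f (p + L y)).
Proof.
elim: s => [//|w s IH]; rewrite -[LHS]/(iterD [:: w] (iterD s _)) IH.
apply/funext => y.
rewrite /= /derive; set F := fun h : R => _; set G := fun h : R => _.
suff -> : F = G by [].
apply/funext => h; rewrite /F /G /=; congr (_ *: (_ - _)).
by rewrite linearD linearZ addrCA.
Qed.

Lemma smooth_affine (W : normedModType R) (L : {linear W -> V}) p f :
  continuous L -> smooth f -> smooth (fun y : W => f (p + L y)).
Proof.
move=> cL sf s y; rewrite iterD_affine.
apply: (@differentiable_comp _ _ _ _ (fun y => p + L y) (iterD (map L s) f : V -> R^o)).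
  apply: differentiableD; first exact: differentiable_cst.
  exact: linear_differentiable.
exact: sf.
Qed.

Lemma is_derive_line f z v (s : R) : smooth f ->
  is_derive s 1 ((fun r : R => f (z + r *: v)) : R -> R^o)
            (iterD [:: v] f (z + s *: v)).
Proof.
move=> sf.
have E : (fun h : R => h^-1 *: (((fun r : R => f (z + r *: v) : R^o) \o shift s) (h *: (1:R)) -
             (f (z + s *: v) : R^o)))
       = (fun h : R => h^-1 *: (((f : V -> R^o) \o shift (z + s *: v)) (h *: v) - f (z + s *: v))).
  apply/funext => h /=; congr (_ *: (f _ - _)).
  by rewrite [h *: 1]mulr1 scalerDl addrCA addrC -!addrA [s *: v + _]addrC.
have D := smooth_derivable (z + s *: v) v sf.
apply: DeriveDef; first by rewrite /derivable E.
by rewrite /= /derive E.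
Qed.

Lemma mvt_line f z v (s : R) : smooth f -> 0 <= s ->
  exists2 c : R, 0 <= c <= s &
    f (z + s *: v) - f z = s * iterD [:: v] f (z + c *: v).
Proof.
move=> sf s0.
have dl r := is_derive_line z v r sf.
have cl : {within `[0, s], continuous (fun r : R => f (z + r *: v))}.
  by apply: derivable_within_continuous => r _; have [] := dl r.
have [c cs H] := MVT_segment s0 (fun r _ => dl r) cl.
exists c; first by move: cs; rewrite in_itv.
by move: H; rewrite scale0r addr0 subr0 => ->; rewrite mulrC.
Qed.

(** The second difference of [f] over the parallelogram spanned by [r *: u] and
    [r *: v], divided by [r ^+ 2], is a value of either mixed derivative near
    [z], by the mean value theorem applied in the two possible orders; the
    mixed derivatives being continuous, they agree at [z]. *)
Lemma iterD_swap f u v : smooth f -> iterD [:: u; v] f = iterD [:: v; u] f.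
Proof.
move=> sf.
have secdiff u1 v1 z r : 0 < r -> exists c d : R, [/\ 0 <= c <= r, 0 <= d <= r &
    f (z + r *: u1 + r *: v1) - f (z + r *: u1) - (f (z + r *: v1) - f z) =
      r ^+ 2 * iterD [:: v1; u1] f (z + c *: u1 + d *: v1)].
  move=> r0.
  pose q y := f (y + r *: v1) + (-1) * f y.
  have st : smooth (fun y => f (y + r *: v1)).
    rewrite (_ : (fun y => _) = (fun y => f (r *: v1 + idfun y))); last first.
      by apply/funext => y; rewrite addrC.
    by apply: smooth_affine => // y; exact: cvg_id.
  have st2 y : iterD [:: u1] (fun y => f (y + r *: v1)) y = iterD [:: u1] f (y + r *: v1).
    rewrite (_ : (fun y => _) = (fun y => f (r *: v1 + idfun y))); last first.
      by apply/funext => w; rewrite addrC.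
    by rewrite iterD_affine addrC.
  have sq : smooth q by apply: smoothD (smoothZ _ sf); exact: st.
  have [c cr Hc] := mvt_line z u1 sq (ltW r0).
  have [d dr Hd] := mvt_line (z + c *: u1) v1 (smooth_iterD [:: u1] sf) (ltW r0).
  exists c, d; split=> //.
  have -> : f (z + r *: u1 + r *: v1) - f (z + r *: u1) - (f (z + r *: v1) - f z) =
     q (z + r *: u1) - q z by rewrite /q; ring.
  rewrite Hc expr2 -mulrA; congr (_ * _).
  rewrite (iterD_cons v1) -Hd.
  rewrite /q iterD1D; [|exact: st|exact: smoothZ].
  by rewrite st2 iterD1Z // mulN1r.
apply/funext => z; apply/eqP; rewrite -subr_eq0 -normr_le0.
rewrite leNgt; apply/negP => e0.
set e := `|_| in e0.
have e20 : 0 < e / 2 by rewrite divr_gt0.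
have c1 := smooth_continuous (smooth_iterD [:: u; v] sf) (x := z).
have c2 := smooth_continuous (smooth_iterD [:: v; u] sf) (x := z).
have /cvgrPdist_lt/(_ _ e20) := c1; rewrite -nbhs_nearE -nbhs_ballE => -[d1 /= d10 B1].
have /cvgrPdist_lt/(_ _ e20) := c2; rewrite -nbhs_nearE -nbhs_ballE => -[d2 /= d20 B2].
pose d := Num.min d1 d2; have d0 : 0 < d by rewrite lt_min d10.
pose r := d / (`|u| + `|v| + 1).
have p0 : 0 < `|u| + `|v| + 1 by rewrite ltr_wpDl // addr_ge0.
have r0 : 0 < r by rewrite divr_gt0.
have near (a b : R) : 0 <= a <= r -> 0 <= b <= r -> `|z - (z + a *: u + b *: v)| < d.
  move=> /andP[a0 ar] /andP[b0 br].
  rewrite -addrA opprD addrA subrr add0r normrN.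
  apply: (le_lt_trans (ler_normD _ _)); rewrite !normrZ !ger0_norm //.
  apply: (@le_lt_trans _ _ (r * (`|u| + `|v|))).
    by rewrite mulrDr lerD // ler_wpM2r.
  by rewrite /r mulrAC -mulrA gtr_pMr // ltr_pdivrMr // mul1r ltrDl.
(* the two orders sample the mixed derivatives at different points, both
   within [d] of [z] *)
have [a [b [ar br Hab]]] := secdiff u v z r r0.
have [a' [b' [ar' br' Hab']]] := secdiff v u z r r0.
have E : iterD [:: v; u] f (z + a *: u + b *: v) =
         iterD [:: u; v] f (z + a' *: v + b' *: u).
  have r2 : r ^+ 2 != 0 by rewrite expf_neq0 // gt_eqF.
  have : r ^+ 2 * iterD [:: v; u] f (z + a *: u + b *: v) =
         r ^+ 2 * iterD [:: u; v] f (z + a' *: v + b' *: u).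
    apply: etrans (esym Hab) _; apply: etrans Hab'.
    rewrite (addrAC z (r *: v)).
    move: (f _) (f _) (f _) (f _) => p1 p2 p3 p4; ring.
  by move/(mulfI r2).
have n1 : `|iterD [:: u; v] f z - iterD [:: u; v] f (z + a' *: v + b' *: u)| < e / 2.
  apply: B1; rewrite -ball_normE /ball_ /=.
  rewrite -addrA [a' *: v + _]addrC addrA; apply: lt_le_trans (near _ _ br' ar') _.
  by rewrite ge_min lexx.
have n2 : `|iterD [:: v; u] f z - iterD [:: v; u] f (z + a *: u + b *: v)| < e / 2.
  apply: B2; rewrite -ball_normE /ball_ /=.
  by apply: lt_le_trans (near _ _ ar br) _; rewrite ge_min lexx orbT.
have : e < e / 2 + e / 2.
  rewrite {1}/e; move: E n1 n2.
  move: (iterD [:: v; u] f _) (iterD [:: u; v] f _) => p q -> n1 n2.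
  apply: le_lt_trans (ltrD n1 n2); rewrite [X in _ <= _ + X]distrC.
  exact: ler_distD.
by rewrite -splitr ltxx.
Qed.

Lemma iterD_swap_head u v s f : smooth f ->
  iterD (u :: v :: s) f = iterD (v :: u :: s) f.
Proof.
move=> sf; have H := @iterD_swap (iterD s f) u v (smooth_iterD s sf).
rewrite -!iterD_cat in H.
exact H.
Qed.

Lemma iterD_perm s1 s2 f : smooth f -> perm_eq s1 s2 -> iterD s1 f = iterD s2 f.
Proof.
move=> sf; have swap v a b : iterD (v :: a ++ b) f = iterD (a ++ v :: b) f.
  elim: a => [//|w a IH]; rewrite !cat_cons iterD_swap_head //.
  by rewrite iterD_cons IH -iterD_cons.
elim: s1 s2 => [|v s1 IH] s2 p12.
  by move: p12; rewrite perm_sym => /perm_nilP ->.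
have vs2 : v \in s2 by rewrite -(perm_mem p12) mem_head.
move: p12; case/splitPr: vs2 => a b p12.
rewrite -(swap v a b) (iterD_cons v s1) (iterD_cons v (a ++ b)) (IH (a ++ b)) //.
by rewrite -(perm_cons v) (perm_trans p12) // perm_catC /= perm_cons perm_catC.
Qed.

(** Integrating the Taylor remainder of the derivative along the segment, by
    the mean value theorem, loses the factor [1 / n!] of the sharp bound but
    keeps the induction elementary. *)
Lemma taylor_line n f z v (B : R) : smooth f ->
  (forall c : R, 0 <= c <= 1 -> `|iterD (nseq n v) f (z + c *: v)| <= B) ->
  forall s : R, 0 <= s <= 1 ->
  `|f (z + s *: v) - \sum_(m < n) s ^+ m / m`!%:R * iterD (nseq m v) f z| <= B.
Proof.
elim: n f => [|n IH] f sf Hb s s01.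
  by rewrite big_ord0 subr0; exact: Hb.
pose Q (r : R) := f (z + r *: v) - \sum_(m < n.+1) r ^+ m / m`!%:R * iterD (nseq m v) f z.
pose Q' (r : R) := iterD [:: v] f (z + r *: v) -
   \sum_(m < n) r ^+ m / m`!%:R * iterD (nseq m v) (iterD [:: v] f) z.
have nD m : iterD (nseq m v) (iterD [:: v] f) = iterD (nseq m.+1 v) f.
  by rewrite -iterD_cat -(nseqD m 1) addn1.
have Q'B r : 0 <= r <= 1 -> `|Q' r| <= B.
  apply: IH; first exact: smooth_iterD.
  by move=> c c01; rewrite nD; exact: Hb.
have dQ (r : R) : is_derive r (1 : R) (Q : R -> R^o) (Q' r).
  have dl := is_derive_line z v r sf.
  pose p : {poly R} := \poly_(m < n.+1) (m`!%:R^-1 * iterD (nseq m v) f z).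
  have Qe : Q = (fun r => f (z + r *: v) - p.[r]).
    apply/funext => q; rewrite /Q /p horner_poly; congr (_ - _).
    by apply: eq_bigr => m _; rewrite [RHS]mulrC mulrA.
  have pe : p^`().[r] = \sum_(m < n) r ^+ m / m`!%:R * iterD (nseq m v) (iterD [:: v] f) z.
    have -> : p^`() = \poly_(m < n) (m`!%:R^-1 * iterD (nseq m.+1 v) f z).
      apply/polyP => m; rewrite coef_deriv !coef_poly ltnS; case: ltnP => _; last by rewrite mul0rn.
      rewrite -[LHS]mulr_natr mulrAC; congr (_ * _).
      by rewrite factS natrM invfM mulrAC mulVf ?mul1r // pnatr_eq0.
    rewrite horner_poly; apply: eq_bigr => m _.
    by rewrite nD [LHS]mulrC mulrA.
  have dp : is_derive r (1 : R) ((fun x => p.[x]) : R -> R^o) (p^`().[r]) by exact: is_derive_poly.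
  rewrite Qe /Q' -pe.
  exact: (is_deriveB dl dp).
have cQ : {within `[0, s], continuous Q}.
  by apply: derivable_within_continuous => r _; have [] := dQ r.
have /andP[s0 s1] := s01.
have [c cs H] := MVT_segment s0 (fun r _ => dQ r) cQ.
have Q0 : Q 0 = 0.
  rewrite /Q scale0r addr0 big_ord_recl big1 ?expr0 ?fact0 ?divr1 ?mul1r ?addr0 ?subrr // => m _.
  by rewrite /= exprS !mul0r.
move: H; rewrite Q0 !subr0 => H.
rewrite -/(Q s) H normrM (ger0_norm s0).
move: cs; rewrite in_itv /= => /andP[c0 c1].
have QB : `|Q' c| <= B by apply: Q'B; rewrite c0 (le_trans c1).
by rewrite -[B]mulr1 ler_pM.
Qed.

(** Expanding one copy of the direction at a time keeps a word of the form
    [map e s1 ++ nseq p v], on which the induction runs. *)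
Lemma iterD_nseq_le (J : finType) (y : J -> R) (e : J -> V) f z m (B : R) :
  smooth f ->
  (forall s : m.-tuple J, `|iterD (map e s) f z| <= B) ->
  `|iterD (nseq m (\sum_j y j *: e j)) f z| <= (\sum_j `|y j|) ^+ m * B.
Proof.
move=> sf Hb.
suff H : forall (p : nat) (s1 : seq J), (size s1 + p = m)%N ->
   `|iterD (map e s1 ++ nseq p (\sum_j y j *: e j)) f z| <= (\sum_j `|y j|) ^+ p * B.
  exact: (H m [::]).
elim=> [|p IH] s1 sz.
  rewrite cats0 expr0 mul1r.
  have ss : size s1 == m by rewrite -sz addn0.
  exact: (Hb (Tuple ss)).
rewrite [nseq _ _]/= iterD_multilinear //.
apply: (le_trans (ler_norm_sum _ _ _)).
rewrite exprS -mulrA mulr_suml; apply: ler_sum => j _.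
rewrite normrM ler_wpM2l //.
have := IH (rcons s1 j); rewrite size_rcons map_rcons cat_rcons; apply.
by rewrite addSnnS.
Qed.

End DirectionalDerivatives.
Section DirectionalTaylor.
Context {R : realType} {V : normedModType R}.
Implicit Types (f : V -> R) (z v : V).

Lemma iterD_nseqZ m (c : R) v f z : smooth f ->
  iterD (nseq m (c *: v)) f z = c ^+ m * iterD (nseq m v) f z.
Proof.
move=> sf.
suff -> : iterD (nseq m (c *: v)) f = (fun z => c ^+ m * iterD (nseq m v) f z) by [].
elim: m => [|m IH]; first by apply/funext => y; rewrite mul1r.
rewrite [nseq m.+1 _]/= iterD_cons IH iterD1Z; last exact: smooth_iterD.
apply/funext => y; rewrite exprSr -mulrA; congr (_ * _).
have dg := smooth_iterD (nseq m v) sf [::] y.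
by rewrite /= !deriveE // linearZ.
Qed.

Lemma taylor_direction n f z v (eta B : R) : smooth f ->
  (forall c : R, 0 <= c <= 1 -> `|iterD (nseq n v) f (z + (c * eta) *: v)| <= B) ->
  `|f (z + eta *: v) - \sum_(m < n) eta ^+ m / m`!%:R * iterD (nseq m v) f z|
    <= `|eta| ^+ n * B.
Proof.
move=> sf Hb.
have /(_ _ _) := @taylor_line _ _ n f z (eta *: v) (`|eta| ^+ n * B) sf.
have Hb' (c : R) : 0 <= c <= 1 ->
    `|iterD (nseq n (eta *: v)) f (z + c *: (eta *: v))| <= `|eta| ^+ n * B.
  move=> c01; rewrite iterD_nseqZ // normrM normrX scalerA ler_wpM2l ?exprn_ge0 //.
  exact: Hb.
have s1 : 0 <= (1 : R) <= 1 by rewrite ler01 lexx.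
move=> /(_ Hb' 1 s1); rewrite scale1r.
rewrite (_ : \sum_(m < n) 1 ^+ m / m`!%:R * _ =
   \sum_(m < n) eta ^+ m / m`!%:R * iterD (nseq m v) f z) //.
by apply: eq_bigr => m _; rewrite iterD_nseqZ // expr1n; ring.
Qed.

(** Order by order, a displacement moment multiplies a derivative: only the
    moment errors and the remainders survive in the sum. *)
Lemma moment_sum_bound (J : finType) n (y : J -> 'I_n -> R)
  (b : 'I_n -> R) (a : 'I_n -> 'I_n -> R) (D1 : 'I_n -> R)
  (D2 : 'I_n -> 'I_n -> R) (D3 : 'I_n -> 'I_n -> 'I_n -> R) (rem : J -> R)
  (eps B1 B2 B3 B4 : R) :
  (forall i, `|\sum_l y l i - b i| <= eps) ->
  (forall i j, `|\sum_l y l i * y l j - 2 * a i j| <= eps) ->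
  (forall i j h, `|\sum_l y l i * y l j * y l h| <= eps) ->
  (forall i, `|D1 i| <= B1) -> (forall i j, `|D2 i j| <= B2) ->
  (forall i j h, `|D3 i j h| <= B3) -> (forall l, `|rem l| <= B4) ->
  `|\sum_l (\sum_i y l i * D1 i + (\sum_i \sum_j y l i * y l j * D2 i j) / 2
            + (\sum_i \sum_j \sum_h y l i * y l j * y l h * D3 i j h) / 6 + rem l)
    - (\sum_i b i * D1 i + \sum_i \sum_j a i j * D2 i j)|
  <= n%:R * (eps * B1) + n%:R * (n%:R * (eps * B2))
     + n%:R * (n%:R * (n%:R * (eps * B3))) + #|J|%:R * B4.
Proof.
move=> y1 y2 y3 f1 f2 f3 f4.
have s1 : \sum_l \sum_i y l i * D1 i = \sum_i (\sum_l y l i) * D1 i.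
  by rewrite exchange_big /=; apply: eq_bigr => i _; rewrite mulr_suml.
have s2 : \sum_l \sum_i \sum_j y l i * y l j * D2 i j =
    \sum_i \sum_j (\sum_l y l i * y l j) * D2 i j.
  rewrite exchange_big /=; apply: eq_bigr => i _.
  by rewrite exchange_big /=; apply: eq_bigr => j _; rewrite mulr_suml.
have s3 : \sum_l \sum_i \sum_j \sum_h y l i * y l j * y l h * D3 i j h =
    \sum_i \sum_j \sum_h (\sum_l y l i * y l j * y l h) * D3 i j h.
  rewrite exchange_big /=; apply: eq_bigr => i _.
  rewrite exchange_big /=; apply: eq_bigr => j _.
  by rewrite exchange_big /=; apply: eq_bigr => h _; rewrite mulr_suml.
rewrite !big_split /= -!mulr_suml s1 s2 s3.
have t1 : \sum_i (\sum_l y l i - b i) * D1 i =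
   \sum_i (\sum_l y l i) * D1 i - \sum_i b i * D1 i.
  by rewrite -sumrB; apply: eq_bigr => i _; rewrite mulrBl.
have t2 : \sum_i \sum_j (\sum_l y l i * y l j - 2 * a i j) * D2 i j =
   \sum_i \sum_j (\sum_l y l i * y l j) * D2 i j - 2 * \sum_i \sum_j a i j * D2 i j.
  rewrite mulr_sumr -sumrB; apply: eq_bigr => i _.
  rewrite mulr_sumr -sumrB; apply: eq_bigr => j _.
  by rewrite mulrBl mulrA.
have alg (S1 S2 S3 S4 Sb Sa : R) : S1 + S2 / 2 + S3 / 6 + S4 - (Sb + Sa) =
  S1 - Sb + (S2 - 2 * Sa) / 2 + S3 / 6 + S4 by field.
rewrite alg -t1 -t2.
have sumB (F : 'I_n -> R) (c : R) : (forall i, `|F i| <= c) ->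
    `|\sum_i F i| <= n%:R * c.
  move=> Fc; apply: (le_trans (ler_norm_sum _ _ _)).
  rewrite mulr_natl -[n in X in _ <= X]card_ord -sumr_const.
  by apply: ler_sum.
have b1 : `|\sum_i (\sum_l y l i - b i) * D1 i| <= n%:R * (eps * B1).
  by apply: (sumB) => i; rewrite normrM ler_pM.
have b2 : `|\sum_i \sum_j (\sum_l y l i * y l j - 2 * a i j) * D2 i j|
   <= n%:R * (n%:R * (eps * B2)).
  by apply: (sumB) => i; apply: (sumB) => j; rewrite normrM ler_pM.
have b3 : `|\sum_i \sum_j \sum_h (\sum_l y l i * y l j * y l h) * D3 i j h|
   <= n%:R * (n%:R * (n%:R * (eps * B3))).
  by apply: (sumB) => i; apply: (sumB) => j; apply: (sumB) => h; rewrite normrM ler_pM.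
have b4 : `|\sum_l rem l| <= #|J|%:R * B4.
  apply: (le_trans (ler_norm_sum _ _ _)); rewrite mulr_natl -sumr_const.
  exact: ler_sum.
apply: (le_trans (ler_normD _ _)); apply: lerD b4.
apply: (le_trans (ler_normD _ _)); apply: lerD.
  apply: (le_trans (ler_normD _ _)); apply: lerD b1 _.
  rewrite normrM; apply: le_trans b2.
  by rewrite ler_piMr // ger0_norm // invf_le1 // ler1n.
rewrite normrM; apply: le_trans b3.
by rewrite ler_piMr // ger0_norm // invf_le1 // ler1n.
Qed.

(** A finite family of displacements whose moments of order one to three match,
    up to [eps], those of a second-order operator reproduces that operator up
    to the third moments and the fourth-order Taylor remainder. *)
Lemma moment_expansion (J : finType) n (e : 'I_n -> V) (y : J -> 'I_n -> R)
  (b : 'I_n -> R) (a : 'I_n -> 'I_n -> R) f p (eps rho B1 B2 B3 B4 : R) :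
  smooth f -> 0 <= B4 ->
  (forall i, `|\sum_l y l i - b i| <= eps) ->
  (forall i j, `|\sum_l y l i * y l j - 2 * a i j| <= eps) ->
  (forall i j h, `|\sum_l y l i * y l j * y l h| <= eps) ->
  (forall l i, `|y l i| <= rho) ->
  (forall s : 1.-tuple 'I_n, `|iterD (map e s) f p| <= B1) ->
  (forall s : 2.-tuple 'I_n, `|iterD (map e s) f p| <= B2) ->
  (forall s : 3.-tuple 'I_n, `|iterD (map e s) f p| <= B3) ->
  (forall (s : 4.-tuple 'I_n) (c : R) l, 0 <= c <= 1 ->
     `|iterD (map e s) f (p + c *: \sum_i y l i *: e i)| <= B4) ->
  `|\sum_l (f (p + \sum_i y l i *: e i) - f p)
    - (\sum_i b i * iterD [:: e i] f p
       + \sum_i \sum_j a i j * iterD [:: e i; e j] f p)|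
  <= n%:R * (eps * B1) + n%:R * (n%:R * (eps * B2))
     + n%:R * (n%:R * (n%:R * (eps * B3))) + #|J|%:R * ((n%:R * rho) ^+ 4 * B4).
Proof.
move=> sf B40 y1 y2 y3 yr f1 f2 f3 f4.
pose v l := \sum_i y l i *: e i.
pose rem l := f (p + v l) - (f p + iterD [:: v l] f p + iterD [:: v l; v l] f p / 2
    + iterD [:: v l; v l; v l] f p / 6).
have remB l : `|rem l| <= (n%:R * rho) ^+ 4 * B4.
  have Hb (c : R) : 0 <= c <= 1 ->
      `|iterD (nseq 4 (v l)) f (p + c *: v l)| <= (n%:R * rho) ^+ 4 * B4.
    move=> c01; apply: (@le_trans _ _ ((\sum_i `|y l i|) ^+ 4 * B4)).
      by apply: iterD_nseq_le => // s; exact: f4.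
    have yn : \sum_i `|y l i| <= n%:R * rho.
      rewrite mulr_natl -[n in X in _ <= X]card_ord -sumr_const.
      by apply: ler_sum => i _; exact: yr.
    have y0 : 0 <= \sum_i `|y l i| by apply: sumr_ge0 => i _.
    by rewrite ler_wpM2r // ler_pXn2r // ?nnegrE // (le_trans y0).
  have s1 : 0 <= (1 : R) <= 1 by rewrite ler01 lexx.
  have := taylor_line sf Hb s1; rewrite scale1r.
  have sum4 (g : nat -> R) : \sum_(m < 4) 1 ^+ m / m`!%:R * g m =
      g 0%N + g 1%N + g 2 / 2 + g 3 / 6.
    rewrite !big_ord_recr big_ord0 /= !expr1n add0r.
    by rewrite (_ : 0`! = 1)%N // (_ : 1`! = 1)%N // (_ : 2`! = 2)%N // (_ : 3`! = 6)%N //; field.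
  by rewrite (sum4 (fun m => iterD (nseq m (v l)) f p)).
have d1 l : iterD [:: v l] f p = \sum_i y l i * iterD [:: e i] f p.
  exact: (iterD_multilinear (y l) e [::] [::] p sf).
have d2 l : iterD [:: v l; v l] f p =
    \sum_i \sum_j y l i * y l j * iterD [:: e i; e j] f p.
  rewrite (iterD_multilinear (y l) e [::] [:: v l] p sf); apply: eq_bigr => i _.
  rewrite (iterD_multilinear (y l) e [:: e i] [::] p sf) mulr_sumr.
  by apply: eq_bigr => j _; rewrite mulrA.
have d3 l : iterD [:: v l; v l; v l] f p =
    \sum_i \sum_j \sum_h y l i * y l j * y l h * iterD [:: e i; e j; e h] f p.
  rewrite (iterD_multilinear (y l) e [::] [:: v l; v l] p sf); apply: eq_bigr => i _.
  rewrite (iterD_multilinear (y l) e [:: e i] [:: v l] p sf) mulr_sumr.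
  apply: eq_bigr => j _.
  rewrite (iterD_multilinear (y l) e [:: e i; e j] [::] p sf) !mulr_sumr.
  by apply: eq_bigr => h _; rewrite !mulrA.
have -> : \sum_l (f (p + \sum_i y l i *: e i) - f p) =
   \sum_l (\sum_i y l i * iterD [:: e i] f p
      + (\sum_i \sum_j y l i * y l j * iterD [:: e i; e j] f p) / 2
      + (\sum_i \sum_j \sum_h y l i * y l j * y l h * iterD [:: e i; e j; e h] f p) / 6
      + rem l).
  apply: eq_bigr => l _.
  have alg (P Q S1 S2 S3 S1' S2' S3' : R) : S1 = S1' -> S2 = S2' -> S3 = S3' ->
    P - Q = S1' + S2' / 2 + S3' / 6 + (P - (Q + S1 + S2 / 2 + S3 / 6)).
    by move=> -> -> ->; ring.
  exact: (alg _ _ _ _ _ _ _ _ (d1 l) (d2 l) (d3 l)).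
apply: (@moment_sum_bound _ _ y b a (fun i => iterD [:: e i] f p)
  (fun i j => iterD [:: e i; e j] f p) (fun i j h => iterD [:: e i; e j; e h] f p)) => //.
- by move=> i; exact: (f1 [tuple i]).
- by move=> i j; exact: (f2 [tuple i; j]).
- by move=> i j h; exact: (f3 [tuple i; j; h]).
Qed.

End DirectionalTaylor.
(** * Suprema and inf sup *)

Section Suprema.
Context {R : realType}.

Lemma norm0_ubound (Z V : Type) (nrm : V -> R) (D : set Z) (w : Z -> V) z :
  D z -> ((nrm (w z))%:E <= norm0 nrm D w)%E.
Proof. by move=> Dz; apply: ereal_sup_ubound; exists z. Qed.

Lemma norm0_le (Z V : Type) (nrm : V -> R) (D : set Z) (w : Z -> V) (c : \bar R) :
  (forall z, D z -> ((nrm (w z))%:E <= c)%E) -> (norm0 nrm D w <= c)%E.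
Proof. by move=> H; apply: ge_ereal_sup => _ [z Dz <-]; exact: H. Qed.

Lemma norm0_ge0 (Z V : Type) (nrm : V -> R) (D : set Z) (w : Z -> V) :
  D !=set0 -> (forall v, 0 <= nrm v) -> (0 <= norm0 nrm D w)%E.
Proof.
move=> [z Dz] n0; apply: le_trans (norm0_ubound nrm w Dz).
by rewrite lee_fin.
Qed.

Lemma norm0_bound (Z V : Type) (nrm : V -> R) (D : set Z) (w : Z -> V) (c : R) z :
  (norm0 nrm D w <= c%:E)%E -> D z -> nrm (w z) <= c.
Proof. by move=> H Dz; rewrite -lee_fin; apply: le_trans H; exact: norm0_ubound. Qed.

Lemma enorm_ge0 m n (A : 'M[R]_(m, n)) : 0 <= enorm A.
Proof. exact: sqrtr_ge0. Qed.

Lemma enorm_entry m n (A : 'M[R]_(m, n)) i j : `|A i j| <= enorm A.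
Proof.
rewrite -sqrtr_sqr ler_sqrt; last by apply: sumr_ge0 => k _; apply: sumr_ge0 => l _; exact: sqr_ge0.
rewrite (bigD1 i) //= (bigD1 j) //= -addrA lerDl addr_ge0 //.
  by apply: sumr_ge0 => l _; exact: sqr_ge0.
by apply: sumr_ge0 => k _; apply: sumr_ge0 => l _; exact: sqr_ge0.
Qed.

Section InfSup.
Context {A B : Type}.
Implicit Types H G : A -> B -> R.

Lemma inf_sup_leD H G (e : R) : (forall a b, H a b <= G a b + e) ->
  (inf_sup H <= inf_sup G + e%:E)%E.
Proof.
move=> HG; rewrite -leeBlDr //; apply: le_ereal_inf_tmp => _ [a _ <-].
rewrite leeBlDr //.
apply: (@le_trans _ _ (ereal_sup [set (H a b)%:E | b in setT])).
  by apply: ereal_inf_lbound; exists a.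
apply: ge_ereal_sup => _ [b _ <-].
rewrite (@le_trans _ _ ((G a b)%:E + e%:E)%E) //; first by rewrite -EFinD lee_fin.
by rewrite leeD2r //; apply: ereal_sup_ubound; exists b.
Qed.

Lemma inf_sup_fin H (c : R) (a0 : A) (b0 : B) : (forall a b, `|H a b| <= c) ->
  inf_sup H \is a fin_num.
Proof.
move=> Hc; rewrite fin_real //; apply/andP; split.
  apply: (@lt_le_trans _ _ (- c)%:E); first by rewrite ltNyr.
  apply: le_ereal_inf_tmp => _ [a _ <-].
  apply: (@le_trans _ _ (H a b0)%:E); last by apply: ereal_sup_ubound; exists b0.
  by rewrite lee_fin lerNl; apply: le_trans (Hc a b0); rewrite -normrN ler_norm.
apply: (@le_lt_trans _ _ c%:E); last by rewrite ltry.
apply: (@le_trans _ _ (ereal_sup [set (H a0 b)%:E | b in setT])).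
  by apply: ereal_inf_lbound; exists a0.
apply: ge_ereal_sup => _ [b _ <-].
by rewrite lee_fin (le_trans (ler_norm _)).
Qed.

Lemma sup_infN H : sup_inf (fun a b => - H a b) = (- inf_sup H)%E.
Proof.
rewrite /sup_inf /inf_sup -ereal_supN image_comp; congr ereal_sup.
apply: eq_imagel => a _ /=; rewrite -ereal_infN image_comp; congr ereal_inf.
Qed.

Lemma sup_inf_eq0 H (d : R) :
  sup_inf (fun a b => d - H a b) = 0%E <-> d%:E = inf_sup H.
Proof.
have -> : (fun a b => d - H a b) = (fun a b => - (H a b - d)).
  by apply/funext => a; apply/funext => b; rewrite opprB.
rewrite sup_infN.
have le1 : (inf_sup (fun a b => (H a b - d)%R) <= inf_sup H + (- d)%:E)%E.
  exact: inf_sup_leD.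
have le2 : (inf_sup H <= inf_sup (fun a b => (H a b - d)%R) + d%:E)%E.
  by apply: inf_sup_leD => a b; rewrite subrK.
split=> [/eqP|E].
  rewrite oppe_eq0 => /eqP E; move: le1 le2; rewrite E add0e => le1 le2.
  by apply/eqP; rewrite eq_le le2 andbT -sube_ge0.
apply/eqP; rewrite oppe_eq0 eq_le; apply/andP; split.
  by apply: le_trans le1 _; rewrite -E -EFinD subrr.
by move: le2; rewrite -E -leeBlDr // -EFinB subrr.
Qed.

Lemma inf_sup_gt H (d e : R) a : 0 < e -> d%:E = inf_sup H ->
  exists b, d - e < H a b.
Proof.
move=> e0 E.
have : ((d - e)%:E < ereal_sup [set (H a b)%:E | b in setT])%E.
  apply: (@lt_le_trans _ _ d%:E); first by rewrite lte_fin ltrBlDr ltrDl.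
  by rewrite E; apply: ereal_inf_lbound; exists a.
by move=> /ereal_sup_gt[_ [b _ <-]]; rewrite lte_fin => Hb; exists b.
Qed.

Lemma inf_sup_lt H (d e : R) : 0 < e -> d%:E = inf_sup H ->
  exists a, forall b, H a b < d + e.
Proof.
move=> e0 E.
have : (inf_sup H < (d + e)%:E)%E by rewrite -E lte_fin ltrDl.
move=> /ereal_inf_lt[_ [a _ <-]] Ha; exists a => b.
rewrite -lte_fin; apply: le_lt_trans Ha.
by apply: ereal_sup_ubound; exists b.
Qed.

End InfSup.
End Suprema.

(** * Interpolation as averaging *)

Section Interpolation.
Context {R : realType}.
Implicit Types (u v : nat -> R) (l : R).

(** Convergence of the partial sums in the order of the enumeration, as in the
    hypothesis on the interpolation; no absolute convergence is implied. *)
Definition sums_to u l : Prop := series u @ \oo --> l.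

Lemma sums_to_lim u l : sums_to u l -> cvgn (series u) /\ limn (series u) = l.
Proof.
move=> ul; split; first by apply/cvg_ex; exists l.
exact: cvg_lim.
Qed.

Lemma sums_toD u v l m : sums_to u l -> sums_to v m ->
  sums_to (fun i => u i + v i) (l + m).
Proof.
move=> ul vm; rewrite /sums_to -[(fun i => _)]/(u + v) seriesD.
exact: cvgD.
Qed.

Lemma sums_toZ u l (c : R) : sums_to u l -> sums_to (fun i => c * u i) (c * l).
Proof.
move=> ul; rewrite /sums_to -[(fun i => _)]/(c *: u) seriesZ.
exact: cvgZr.
Qed.

Lemma sums_to_sum (J : finType) (u : J -> nat -> R) (l : J -> R) :
  (forall j, sums_to (u j) (l j)) ->
  sums_to (fun i => \sum_j u j i) (\sum_j l j).
Proof.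
move=> ul; elim: (index_enum J) => [|j r IH].
  rewrite /sums_to (_ : series _ = cst 0); last first.
    by apply/funext => n; rewrite /series /= big1 // => i _; rewrite big_nil.
  by rewrite big_nil; exact: cvg_cst.
rewrite big_cons (_ : (fun i => _) = (fun i => u j i + \sum_(j <- r) u j i)).
  exact: sums_toD.
by apply/funext => i; rewrite big_cons.
Qed.

Lemma sums_to_delta (c : R) j : sums_to (fun i => (i == j)%:R * c) c.
Proof.
apply: cvg_near_cst; exists j.+1 => // n /= jn.
rewrite /series /= (bigD1_seq j) ?mem_index_iota ?iota_uniq //=.
by rewrite eqxx mul1r big1 ?addr0 // => i /negPf ->; rewrite mul0r.
Qed.

Lemma sums_to_le u v l m : (forall i, u i <= v i) -> sums_to u l -> sums_to v m ->
  l <= m.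
Proof.
move=> uv ul vm; apply: (ler_cvg_to ul vm).
by apply: nearW => n; apply: ler_sum => i _.
Qed.

Lemma sums_to_unique u l m : sums_to u l -> sums_to u m -> l = m.
Proof. by move=> /sums_to_lim[_ <-] /sums_to_lim[_ <-]. Qed.

Context {N : nat} {x : R -> nat -> 'rV[R]_N} {I : R -> (nat -> R) -> 'rV[R]_N -> R}.
Context (hI2 : I2' x I) {dx : R} (dx0 : 0 < dx).

(** One weight family for each grid function, chosen once and for all; a weight
    is at most one because all are nonnegative and add up to one. *)
Lemma interp_weights : exists w : (nat -> R) -> nat -> 'rV[R]_N -> R,
  [/\ forall V i y, 0 <= w V i y <= 1,
      forall V y, sums_to (fun i => w V i y * V i) (I dx V y) &
      forall V y, sums_to (fun i => w V i y) 1].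
Proof.
have [w Hw] := choice (hI2 dx0).
exists w; split=> V.
- move=> i y; have [w0 _ _ w1] := Hw V.
  rewrite w0 /=; apply: (@sums_to_le (fun j => (j == i)%:R * w V i y) (fun j => w V j y)).
  + by move=> j; case: eqP => [->|_]; rewrite ?mul1r // mul0r.
  + exact: sums_to_delta.
  + exact: w1.
- move=> y; have [_ wI _ _] := Hw V.
  rewrite (_ : (fun i => _) = (fun i => V i * w V i y)); first exact: wI.
  by apply/funext => i; rewrite mulrC.
- by move=> y; have [_ _ _ w1] := Hw V; exact: w1.
Qed.

Lemma interp_node V j : I dx V (x dx j) = V j.
Proof.
have [w [_ wI wd _]] := hI2 dx0 V.
apply: (sums_to_unique (wI (x dx j))).
rewrite (_ : (fun i => _) = (fun i => (i == j)%:R * V j)); first exact: sums_to_delta.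
by apply/funext => i; rewrite wd mulrC; case: eqP => [->|]; rewrite ?mul0r.
Qed.

Lemma interp_le V (m : R) y : (forall i, V i <= m) -> I dx V y <= m.
Proof.
move=> Vm; have [w [w0 wI _ w1]] := hI2 dx0 V.
rewrite -[m]mulr1; have H := @sums_toZ (w^~ y) 1 m (w1 y).
by apply: sums_to_le (wI y) H => i; rewrite ler_wpM2r.
Qed.

Lemma interp_ge V (m : R) y : (forall i, m <= V i) -> m <= I dx V y.
Proof.
move=> Vm; have [w [w0 wI _ w1]] := hI2 dx0 V.
rewrite -[m]mulr1; have H := @sums_toZ (w^~ y) 1 m (w1 y).
by apply: sums_to_le H (wI y) => i; rewrite ler_wpM2r.
Qed.

Lemma interp_norm_le V (m : R) y : (forall i, `|V i| <= m) -> `|I dx V y| <= m.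
Proof.
move=> Vm; rewrite ler_norml; apply/andP; split.
  by apply: interp_ge => i; have := Vm i; rewrite ler_norml => /andP[].
by apply: interp_le => i; have := Vm i; rewrite ler_norml => /andP[].
Qed.

End Interpolation.
(** * Monotone form of the scheme *)

Definition time_step {R : realType} (t : nat -> R) n : R := t n - t n.-1.

Section MonotoneForm.
Context {R : realType} {N P M : nat} {A B : Type}.
Context (E : @coefficients R N P A B) (Y : @displacements R N A B M).
Context (T theta dt dx k : R) (t : nat -> R) (x : R -> nat -> 'rV[R]_N).
Context (I : R -> (nat -> R) -> 'rV[R]_N -> R).
Context (htheta : 0 <= theta <= 1) (dt0 : 0 < dt) (dx0 : 0 < dx) (k01 : 0 < k <= 1).
Context (ht : time_grid dt t) (hI2 : I2' x I).
Implicit Types (a : A) (b : B) (V : nat -> R) (psi : 'rV[R]_N -> R).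

Local Notation z n j := (tau theta t n, x dx j).
Local Notation h := (time_step t).

(** The part of [Lk] that does not involve the central value. It has total mass
    [M / k ^+ 2], so it is a mean up to this factor. *)
Definition neighbour_mean a b psi (z : R * 'rV[R]_N) : R :=
  \sum_i (psi (z.2 + yplus Y k a b i z) + psi (z.2 + yminus Y k a b i z)) / (2 * k ^+ 2).

Lemma step_gt0 n : (0 < n)%N -> 0 < h n.
Proof. by case: n => // n _; have [_ tlt _] := ht; rewrite /time_step /= subr_gt0. Qed.

Lemma step_le n : (0 < n)%N -> h n <= dt.
Proof. by case: n => // n _; have [_ _ tle] := ht; rewrite /time_step /=. Qed.

Let ksq_gt0 : 0 < k ^+ 2.
Proof. by case/andP: k01 => k0 _; rewrite exprn_gt0. Qed.

Lemma Lk_neighbour_mean a b psi p :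
  Lk Y k a b psi p = neighbour_mean a b psi p - M%:R / k ^+ 2 * psi p.2.
Proof.
have -> : M%:R / k ^+ 2 * psi p.2 = \sum_(i < M) 2 * psi p.2 / (2 * k ^+ 2).
  rewrite sumr_const card_ord -mulr_natl.
  by have := ksq_gt0; move: (k ^+ 2) => q q0; field; rewrite gt_eqF.
by rewrite -sumrB; apply: eq_bigr => i _; rewrite -mulrBl; congr (_ / _); ring.
Qed.

Lemma neighbour_mean_comb a b psi psi' (s r : R) p :
  neighbour_mean a b (fun y => s * psi y + r * psi' y) p =
  s * neighbour_mean a b psi p + r * neighbour_mean a b psi' p.
Proof.
rewrite /neighbour_mean !mulr_sumr -big_split /=; apply: eq_bigr => i _.
by rewrite !mulrA -mulrDl; congr (_ / _); ring.
Qed.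

Lemma neighbour_mean_norm_le a b psi (m : R) p : (forall y, `|psi y| <= m) ->
  `|neighbour_mean a b psi p| <= M%:R / k ^+ 2 * m.
Proof.
move=> pm; apply: (le_trans (ler_norm_sum _ _ _)).
have -> : M%:R / k ^+ 2 * m = \sum_(i < M) m / k ^+ 2.
  by rewrite sumr_const card_ord -mulr_natl; ring.
apply: ler_sum => i _.
have q0 := ksq_gt0; have q20 : 0 < 2 * k ^+ 2 by rewrite mulr_gt0.
rewrite normrM normfV (gtr0_norm q20) ler_pdivrMr //.
apply: (le_trans (ler_normD _ _)).
apply: (le_trans (lerD (pm _) (pm _))).
by rewrite mulrCA divfK ?gt_eqF // mulr_natl mulr2n.
Qed.

(** What stands under inf sup in the scheme: [scheme_rhs] is convertible to its
    [inf_sup]. *)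
Definition hamiltonian U n j a b : R :=
  Lk Y k a b (fun y => (1 - theta) * I dx (U n.-1) y + theta * I dx (U n) y) (z n j)
  + zeroth E a b (z n j) * ((1 - theta) * U n.-1 j + theta * U n j)
  + source E a b (z n j).

Lemma hamiltonian_neighbour_mean U n j a b :
  hamiltonian U n j a b =
    (1 - theta) * (neighbour_mean a b (I dx (U n.-1)) (z n j)
                   - (M%:R / k ^+ 2 - zeroth E a b (z n j)) * U n.-1 j)
  + theta * (neighbour_mean a b (I dx (U n)) (z n j)
             - (M%:R / k ^+ 2 - zeroth E a b (z n j)) * U n j)
  + source E a b (z n j).
Proof.
rewrite /hamiltonian Lk_neighbour_mean neighbour_mean_comb !(interp_node hI2) //.
ring.
Qed.

Context (hCFL : CFL E M theta k t (x dx) T dt).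

Local Notation c n j a b := (zeroth E a b (z n j)).

Let le_inv_step n (p : R) : (0 < n)%N -> dt * p <= 1 -> p <= (h n)^-1.
Proof.
move=> n0 H; have [h0 hd] := (step_gt0 n0, step_le n0).
have [p0|p0] := leP p 0; first by rewrite (le_trans p0) // invr_ge0 ltW.
rewrite -[(h n)^-1]mul1r ler_pdivlMr //; apply: le_trans H.
by rewrite mulrC ler_wpM2r // ltW.
Qed.

Lemma CFL_explicit n j a b : (0 < n)%N -> t n <= T ->
  0 <= (h n)^-1 - (1 - theta) * (M%:R / k ^+ 2 - c n j a b).
Proof.
move=> n0 tn; have [H _] := hCFL a b j n0 tn.
by rewrite subr_ge0 le_inv_step // mulrA (mulrC dt).
Qed.

Lemma CFL_implicit n j a b : (0 < n)%N -> t n <= T ->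
  0 <= (h n)^-1 - theta * c n j a b.
Proof.
move=> n0 tn; have [_ H] := hCFL a b j n0 tn.
by rewrite subr_ge0 le_inv_step // mulrA (mulrC dt).
Qed.

(** The equation is used as it stands, not multiplied by the time step, so the
    time derivative contributes the inverse of the step to the diagonal
    coefficients. The diagonal weight of the implicit part is moved to the left
    and must be dominated: it is at most [M / k ^+ 2]. *)
Lemma scheme_class_Ltilde :
  class_Ltilde A B T t (scheme_eq E Y theta k t (x dx) (I dx)).
Proof.
have [w [w01 wI w1]] := interp_weights hI2 dx0.
pose mass V n j a b i := neighbour_mean a b (w V i) (z n j).
have mass_sum V n j a b :
    sums_to (fun i => mass V n j a b i * V i) (neighbour_mean a b (I dx V) (z n j)).
  rewrite (_ : (fun i => _) = (fun i => \sum_l (2 * k ^+ 2)^-1 *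
     (w V i ((z n j).2 + yplus Y k a b l (z n j)) * V i +
      w V i ((z n j).2 + yminus Y k a b l (z n j)) * V i))); last first.
    apply/funext => i; rewrite /mass /neighbour_mean mulr_suml.
    by apply: eq_bigr => l _; ring.
  rewrite /neighbour_mean.
  under eq_bigr do rewrite mulrC.
  by apply: sums_to_sum => l; apply: sums_toZ; apply: sums_toD; exact: wI.
have mass_ge0 V n j a b i : 0 <= mass V n j a b i.
  apply: sumr_ge0 => l _; apply: divr_ge0; last by rewrite mulr_ge0 // ltW.
  by apply: addr_ge0; [have /andP[] := w01 V i ((z n j).2 + yplus Y k a b l (z n j))
                      |have /andP[] := w01 V i ((z n j).2 + yminus Y k a b l (z n j))].
have mass_le V n j a b i : mass V n j a b i <= M%:R / k ^+ 2.
  rewrite -[X in _ <= X]mulr1; apply: le_trans (ler_norm _) _.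
  apply: neighbour_mean_norm_le => y; have /andP[w0 wle1] := w01 V i y.
  by rewrite ger0_norm.
have [th0 th1] := andP htheta.
pose mu n j a b := M%:R / k ^+ 2 - c n j a b.
pose C a b n m V j i : R :=
  if m == n then
    if i == j then (h n)^-1 + theta * mu n j a b - theta * mass V n j a b j
    else theta * mass V n j a b i
  else (i == j)%:R * ((h n)^-1 - (1 - theta) * mu n j a b)
       + (1 - theta) * mass V n j a b i.
exists C, (fun a b n j => source E a b (z n j)) => n j n0 tn.
have nn : (n.-1 == n) = false by rewrite -[X in _ == X]prednK // ltn_eqF.
have Cexp a b V i : C a b n n.-1 V j i =
    (i == j)%:R * ((h n)^-1 - (1 - theta) * mu n j a b) + (1 - theta) * mass V n j a b i.
  by rewrite /C nn.
split=> [a b V i|U implicit explicit].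
  split; last first.
    rewrite Cexp addr_ge0 //; last by rewrite mulr_ge0 // subr_ge0.
    by rewrite mulr_ge0 // CFL_explicit.
  rewrite /C eqxx; case: eqP => [_|_]; last by rewrite mulr_ge0.
  have := CFL_implicit j a b n0 tn.
  have : theta * mass V n j a b j <= theta * (M%:R / k ^+ 2) by rewrite ler_wpM2l.
  rewrite /mu; lra.
pose J m a b := neighbour_mean a b (I dx (U m)) (z n j).
have impl a b : sums_to (implicit a b)
    (theta * J n a b - theta * mass (U n) n j a b j * U n j).
  rewrite (_ : implicit a b = (fun i => theta * (mass (U n) n j a b i * U n i) +
     (i == j)%:R * - (theta * mass (U n) n j a b j * U n j))).
    by apply: sums_toD; [apply: sums_toZ; exact: mass_sum|exact: sums_to_delta].
  apply/funext => i; rewrite /implicit /C eqxx.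
  by case: eqP => [->|_]; rewrite /=; ring.
have expl a b : sums_to (explicit a b)
    ((1 - theta) * J n.-1 a b + ((h n)^-1 - (1 - theta) * mu n j a b) * U n.-1 j).
  rewrite (_ : explicit a b = (fun i => (1 - theta) * (mass (U n.-1) n j a b i * U n.-1 i) +
     (i == j)%:R * (((h n)^-1 - (1 - theta) * mu n j a b) * U n.-1 j))).
    by apply: sums_toD; [apply: sums_toZ; exact: mass_sum|exact: sums_to_delta].
  apply/funext => i; rewrite /explicit Cexp.
  by case: eqP => [->|_]; rewrite /=; ring.
split.
  by move=> a b; split; [have [] := sums_to_lim (impl a b)|have [] := sums_to_lim (expl a b)].
rewrite (_ : (fun a b => _) = (fun a b => delta_t t U n j - hamiltonian U n j a b)); last first.
  apply/funext => a; apply/funext => b.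
  have [_ ->] := sums_to_lim (impl a b).
  have [_ ->] := sums_to_lim (expl a b).
  rewrite hamiltonian_neighbour_mean /C !eqxx /delta_t -/(h n) /mu /J.
  ring.
by split=> /sup_inf_eq0.
Qed.
(** * Discrete maximum principle *)

Lemma grid_time_ge0 n : 0 <= t n.
Proof.
have [<- tlt _] := ht.
by apply: (homo_leq lexx le_trans (fun i => ltW (tlt i))).
Qed.

Lemma tau_slab n (y : 'rV[R]_N) : (0 < n)%N -> t n <= T ->
  slab T (tau theta t n, y).
Proof.
case: n => // n _ tn; have [_ tlt _] := ht; have [th0 th1] := andP htheta.
have tn0 := grid_time_ge0 n.
have hn : 0 <= t n.+1 - t n by rewrite subr_ge0 ltW.
rewrite /slab /= /tau /=; apply/andP; split; first by rewrite addr_ge0 ?mulr_ge0.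
apply: le_trans tn; rewrite -[X in _ <= X](subrKC (t n)) lerD2l.
by rewrite -[X in _ <= X]mul1r ler_wpM2r.
Qed.

Context (a0 : A) (b0 : B) (c0 f0 : R).
Context (hc : forall a b p, slab T p -> zeroth E a b p <= c0).
Context (hf : forall a b p, slab T p -> `|source E a b p| <= f0).
Context (c0_ge0 : 0 <= c0) (hstep : 2 * theta * dt * c0 <= 1).

(** Where [U n j >= 0] an upper bound is needed: the difference quotient is at
    most the supremum over [b] at any frozen [a]. Where [U n j < 0] a lower
    bound is needed, and a nearly minimizing [a] works with any frozen [b]. *)
Lemma scheme_pointwise_bound U n j (m m' : R) : (0 < n)%N -> t n <= T ->
  scheme_eq E Y theta k t (x dx) (I dx) U n j ->
  (forall i, `|U n.-1 i| <= m') -> (forall i, `|U n i| <= m) ->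
  `|U n j| * ((h n)^-1 + theta * (M%:R / k ^+ 2) - theta * c0) <=
  m' * ((h n)^-1 + (1 - theta) * c0) + theta * (M%:R / k ^+ 2) * m + f0.
Proof.
move=> n0 tn eqU Um' Um; have [th0 th1] := andP htheta.
have m'0 : 0 <= m' := le_trans (normr_ge0 _) (Um' 0%N).
have th1' : 0 <= 1 - theta by rewrite subr_ge0.
set q := M%:R / k ^+ 2.
apply/ler_addgt0Pr => e e0.
have sl := tau_slab (x dx j) n0 tn.
have bounds a b : let J' := neighbour_mean a b (I dx (U n.-1)) (z n j) in
  let J := neighbour_mean a b (I dx (U n)) (z n j) in
  [/\ `|J'| <= q * m', `|J| <= q * m, `|source E a b (z n j)| <= f0,
      zeroth E a b (z n j) <= c0 &
      0 <= (h n)^-1 - (1 - theta) * (q - zeroth E a b (z n j))].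
  split; [| |exact: hf|exact: hc|exact: CFL_explicit].
  - by apply: neighbour_mean_norm_le => y; exact: (interp_norm_le hI2).
  - by apply: neighbour_mean_norm_le => y; exact: (interp_norm_le hI2).
move: eqU; rewrite /scheme_eq -[scheme_rhs _ _ _ _ _ _ _ _ _ _]/(inf_sup (hamiltonian U n j)) => eqU.
have u'1 := Um' j; rewrite ler_norml in u'1; have [u'l u'u] := andP u'1.
have [u0|u0] := leP 0 (U n j).
- have [b Hb] := inf_sup_gt a0 e0 eqU.
  move: Hb; rewrite hamiltonian_neighbour_mean /delta_t -/(h n) -/q.
  move: (bounds a0 b) => /= [].
  move: (neighbour_mean _ _ _ _) (neighbour_mean _ _ _ _) => J J'.
  move: (source _ _ _ _) (zeroth _ _ _ _) => f d.
  rewrite !ler_norml => /andP[_ J'q] /andP[_ Jq] /andP[_ ff] cc cfl Hb.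
  have p1 : 0 <= ((h n)^-1 - (1 - theta) * (q - d)) * (m' - U n.-1 j).
    by rewrite mulr_ge0 // subr_ge0.
  have p2 : 0 <= (1 - theta) * (q * m' - J') by rewrite mulr_ge0 // subr_ge0.
  have p3 : 0 <= theta * (q * m - J) by rewrite mulr_ge0 // subr_ge0.
  have p4 : 0 <= theta * U n j * (c0 - d) by rewrite !mulr_ge0 // subr_ge0.
  have p5 : 0 <= m' * (1 - theta) * (c0 - d) by rewrite !mulr_ge0 // subr_ge0.
  rewrite (ger0_norm u0); lra.
- have [a Ha] := inf_sup_lt e0 eqU.
  move: (Ha b0); rewrite hamiltonian_neighbour_mean /delta_t -/(h n) -/q.
  move: (bounds a b0) => /= [].
  move: (neighbour_mean _ _ _ _) (neighbour_mean _ _ _ _) => J J'.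
  move: (source _ _ _ _) (zeroth _ _ _ _) => f d.
  rewrite !ler_norml => /andP[J'q _] /andP[Jq _] /andP[ff _] cc cfl Hb.
  have p1 : 0 <= ((h n)^-1 - (1 - theta) * (q - d)) * (m' + U n.-1 j).
    by rewrite mulr_ge0 // -lerBlDl sub0r.
  have p2 : 0 <= (1 - theta) * (q * m' + J') by rewrite mulr_ge0 // -lerBlDl sub0r.
  have p3 : 0 <= theta * (q * m + J) by rewrite mulr_ge0 // -lerBlDl sub0r.
  have p4 : 0 <= theta * - U n j * (c0 - d).
    by rewrite mulr_ge0 ?subr_ge0 // mulr_ge0 // oppr_ge0 ltW.
  have p5 : 0 <= m' * (1 - theta) * (c0 - d) by rewrite !mulr_ge0 // subr_ge0.
  rewrite (ltr0_norm u0); lra.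
Qed.

(** Taking the supremum over the vertices in the pointwise bound makes the
    neighbour term [theta * (M / k ^+ 2) * m] cancel; this is where the
    boundedness of the solution is needed, for the supremum to be finite. *)
Lemma scheme_step_bound U n (m' : R) : (0 < n)%N -> t n <= T ->
  (exists C : R, forall i, `|U n i| <= C) ->
  (forall j, scheme_eq E Y theta k t (x dx) (I dx) U n j) ->
  (forall i, `|U n.-1 i| <= m') ->
  forall i, `|U n i| * (1 - theta * h n * c0) <=
            (1 + (1 - theta) * h n * c0) * m' + h n * f0.
Proof.
move=> n0 tn [C UC] eqU Um' i; have [th0 th1] := andP htheta.
have [h0 hd] := (step_gt0 n0, step_le n0).
pose S := [set `|U n i| | i in setT].
have S0 : S !=set0 by exists `|U n 0%N|; exists 0%N.
have Sb : has_ubound S by exists C => _ [l _ <-].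
pose m := sup S.
have Um l : `|U n l| <= m by apply: ub_le_sup => //; exists l.
set q := M%:R / k ^+ 2.
have q0 : 0 <= q by rewrite divr_ge0 // ltW.
have th : theta * c0 < (h n)^-1.
  have [tc0|tc0] := leP (theta * c0) 0; first by rewrite (le_lt_trans tc0) // invr_gt0.
  rewrite -[(h n)^-1]mul1r ltr_pdivlMr //.
  apply: (@le_lt_trans _ _ (theta * c0 * dt)); first by rewrite ler_wpM2l // ltW.
  have -> : theta * c0 * dt = 2 * theta * dt * c0 / 2 by field.
  by rewrite ltr_pdivrMr // mul1r (le_lt_trans hstep) // ltr1n.
have D0 : 0 < (h n)^-1 + theta * q - theta * c0.
  have : 0 <= theta * q by rewrite mulr_ge0.
  by move=> ?; lra.
have mD : m * ((h n)^-1 + theta * q - theta * c0) <=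
          m' * ((h n)^-1 + (1 - theta) * c0) + theta * q * m + f0.
  rewrite -ler_pdivlMr //; apply: ge_sup => // _ [l _ <-].
  by rewrite ler_pdivlMr //; exact: scheme_pointwise_bound.
have mh : m * ((h n)^-1 - theta * c0) <= m' * ((h n)^-1 + (1 - theta) * c0) + f0.
  by lra.
have -> : 1 - theta * h n * c0 = h n * ((h n)^-1 - theta * c0).
  by field; rewrite gt_eqF.
have D1 : 0 <= h n * ((h n)^-1 - theta * c0).
  by apply: mulr_ge0; [exact: ltW|rewrite subr_ge0; exact: ltW].
apply: le_trans (ler_wpM2r D1 (Um i)) _.
have -> : (1 + (1 - theta) * h n * c0) * m' + h n * f0 =
          h n * (m' * ((h n)^-1 + (1 - theta) * c0) + f0) by field; rewrite gt_eqF.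
by rewrite mulrCA ler_pM2l.
Qed.

Lemma scheme_stable U (G : R) :
  (exists C : R, forall n i, t n <= T -> `|U n i| <= C) ->
  (forall n i, (0 < n)%N -> t n <= T ->
     scheme_eq E Y theta k t (x dx) (I dx) U n i) ->
  (forall i, `|U 0%N i| <= G) ->
  forall n, t n <= T -> forall i,
    `|U n i| <= expR (2 * c0 * t n) * (G + t n * f0).
Proof.
move=> [C UC] eqU UG; have [t00 tlt _] := ht; have [th0 th1] := andP htheta.
elim=> [|n IH] tn i; first by rewrite t00 mulr0 expR0 mul0r addr0 mul1r.
have tn' : t n <= T by apply: le_trans tn; exact: ltW.
have {}IH := IH tn'.
set m' := expR _ * _ in IH.
have f0_ge0 : 0 <= f0.
  by apply: le_trans (hf a0 b0 (tau_slab 0 (ltn0Sn n) tn)); exact: normr_ge0.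
have G0 : 0 <= G by apply: le_trans (UG 0%N).
have t0 := grid_time_ge0 n.
have h0 := step_gt0 (ltn0Sn n); have hd := step_le (ltn0Sn n).
have := @scheme_step_bound U n.+1 m' (ltn0Sn n) tn
  (ex_intro _ C (fun i => UC n.+1 i tn)) (fun j => eqU n.+1 j (ltn0Sn n) tn) IH i.
set hn := h n.+1 in h0 hd *; set u := `|_| => H.
have u0 : 0 <= u by exact: normr_ge0.
have m'0 : 0 <= m' := le_trans (normr_ge0 _) (IH 0%N).
pose p := theta * hn * c0.
have p0 : 0 <= p by rewrite !mulr_ge0 // ltW.
have p1 : 2 * p <= 1.
  apply: le_trans hstep; rewrite /p -!mulrA ler_pM2l // ler_wpM2l //.
  by rewrite ler_wpM2r.
have q0 : 0 <= (1 - theta) * hn * c0 by rewrite !mulr_ge0 // ?subr_ge0 // ltW.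
(* 1 / (1 - p) <= 1 + 2 p for 0 <= p <= 1 / 2 *)
have Hu : u <= (1 + 2 * p) * ((1 + (1 - theta) * hn * c0) * m' + hn * f0).
  apply: (@le_trans _ _ ((1 + 2 * p) * (u * (1 - p)))).
    have : 0 <= u * p * (1 - 2 * p) by apply: mulr_ge0; [exact: mulr_ge0|rewrite subr_ge0].
    by move=> ?; lra.
  by apply: ler_wpM2l => //; rewrite addr_ge0 // mulr_ge0.
have tE : t n.+1 = t n + hn by rewrite /hn /time_step /= subrKC.
have e1 : 1 + 2 * p <= expR (2 * p) by exact: expR_ge1Dx.
have e2 : 1 + (1 - theta) * hn * c0 <= expR ((1 - theta) * hn * c0) by exact: expR_ge1Dx.
have hc0 : 0 <= hn * c0 by rewrite mulr_ge0 // ltW.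
have thc : theta * (hn * c0) <= hn * c0 by rewrite -[X in _ <= X]mul1r ler_wpM2r.
apply: (le_trans Hu).
apply: (@le_trans _ _ (expR (2 * p) * (expR ((1 - theta) * hn * c0) * m' + hn * f0))).
  apply: ler_pM => //.
  - by rewrite addr_ge0 // mulr_ge0.
  - by apply: addr_ge0; apply: mulr_ge0 => //; [exact: addr_ge0|exact: ltW].
  - by rewrite lerD2r ler_wpM2r.
rewrite mulrDr mulrA -expRD /m' mulrA -expRD {2}tE.
have -> : expR (2 * c0 * t n.+1) * (G + (t n + hn) * f0) =
  expR (2 * c0 * t n.+1) * (G + t n * f0) + expR (2 * c0 * t n.+1) * (hn * f0) by ring.
have tnf : 0 <= t n * f0 by rewrite mulr_ge0.
have hnf : 0 <= hn * f0 by apply: mulr_ge0 => //; exact: ltW.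
have ctn : 0 <= c0 * t n by rewrite mulr_ge0.
apply: lerD; apply: ler_wpM2r; rewrite ?addr_ge0 // ler_expR tE /p; lra.
Qed.

End MonotoneForm.
(** * Suprema of derivatives *)

Section DerivativeSuprema.
Context {R : realType} {N : nat}.
Implicit Types (phi f : R * 'rV[R]_N -> R).

Lemma Dnorm_ge0 (V : normedModType R) n (e : 'I_n -> V) m (f : V -> R) z :
  0 <= Dnorm e m f z.
Proof. exact: sqrtr_ge0. Qed.

Lemma iterD_le_Dnorm (V : normedModType R) n (e : 'I_n -> V) m (f : V -> R) z
  (s : m.-tuple 'I_n) : `|iterD (map e s) f z| <= Dnorm e m f z.
Proof.
rewrite -sqrtr_sqr /Dnorm ler_sqrt; last by apply: sumr_ge0 => i _; exact: sqr_ge0.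
rewrite (bigD1 s) //= lerDl; apply: sumr_ge0 => i _; exact: sqr_ge0.
Qed.

Lemma Dnorm_le_sum (V : normedModType R) n (e : 'I_n -> V) m (f : V -> R) z :
  Dnorm e m f z <= \sum_(s : m.-tuple 'I_n) `|iterD (map e s) f z|.
Proof.
set S := \sum_s _; have S0 : 0 <= S by exact: sumr_ge0.
rewrite -[S]ger0_norm // -sqrtr_sqr /Dnorm ler_sqrt ?sqr_ge0 // expr2 /S mulr_suml.
apply: ler_sum => s _; rewrite -real_normK ?num_real // expr2 ler_wpM2l //.
by rewrite (bigD1 s) //= lerDl; exact: sumr_ge0.
Qed.

Lemma sup_Dx_ge0 (T : R) m phi : 0 < T -> (0 <= sup_Dx T m phi)%E.
Proof.
move=> T0; apply: norm0_ge0 => //.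
by exists (0, 0); rewrite /slab /= lexx ltW.
Qed.

Lemma sup_Dx_bound (T c : R) m phi z (s : m.-tuple 'I_N) : slab T z ->
  (sup_Dx T m phi <= c%:E)%E -> `|iterD (map (@dir_x R N) s) phi z| <= c.
Proof.
move=> Tz H; apply: (le_trans (iterD_le_Dnorm _ _ _ _)).
by rewrite -[X in X <= _]ger0_norm ?Dnorm_ge0 //; exact: norm0_bound H Tz.
Qed.

Lemma sup_Dx_fin (T : R) m s phi : 0 < T -> bounded_derivatives T phi ->
  (0 < m + size s)%N -> sup_Dx T m (iterD s phi) \is a fin_num.
Proof.
move=> T0 bphi ms; rewrite ge0_fin_numE; last exact: sup_Dx_ge0.
pose F w : R := fine (norm0 Num.norm (slab T) (iterD w phi)).
have FP w z : w <> [::] -> slab T z -> `|iterD w phi z| <= F w.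
  move=> w0 Tz; apply: (norm0_bound _ Tz); rewrite fineK // ge0_fin_numE; first exact: bphi.
  by apply: norm0_ge0 => //; exists z.
apply: (@le_lt_trans _ _ (\sum_(w : m.-tuple 'I_N) F (map (@dir_x R N) w ++ s))%:E); last exact: ltry.
apply: norm0_le => z Tz; rewrite lee_fin ger0_norm ?Dnorm_ge0 //.
apply: (le_trans (Dnorm_le_sum _ _ _ _)); apply: ler_sum => w _.
rewrite -iterD_cat; apply: FP => // E.
by move: ms; rewrite -[m](size_tuple w) -(size_map (@dir_x R N)) -size_cat E.
Qed.

End DerivativeSuprema.

(** * Consistency in time *)

Section TimeConsistency.
Context {R : realType} {N : nat} (T theta dt : R) (t : nat -> R).
Context (htheta : 0 <= theta <= 1) (ht : time_grid dt t).
Implicit Types (phi f : R * 'rV[R]_N -> R) (y : 'rV[R]_N).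

Local Notation h := (time_step t).

Let th0 : 0 <= theta. Proof. by case/andP: htheta. Qed.
Let th1 : 0 <= 1 - theta. Proof. by case/andP: htheta => ? ?; rewrite subr_ge0. Qed.

Let end_point n y : (t n, y) = (tau theta t n, y) + ((1 - theta) * h n) *: @dir_t R N.
Proof.
congr (_, _) => /=; last by rewrite scaler0 addr0.
by rewrite /tau /time_step /GRing.scale /= mulr1; ring.
Qed.

Let start_point n y : (t n.-1, y) = (tau theta t n, y) + (- (theta * h n)) *: @dir_t R N.
Proof.
congr (_, _) => /=; last by rewrite scaler0 addr0.
by rewrite /tau /time_step /GRing.scale /= mulr1; ring.
Qed.

Let slab_end n y (c : R) : (0 < n)%N -> t n <= T -> 0 <= c <= 1 ->
  slab T ((tau theta t n, y) + (c * ((1 - theta) * h n)) *: @dir_t R N).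
Proof.
move=> n0 tn /andP[c0 c1].
have t0 := grid_time_ge0 ht n.-1; have h0 := step_gt0 ht n0.
have E1 : c * ((1 - theta) * h n) <= (1 - theta) * h n.
  by rewrite ler_piMl // mulr_ge0 // ltW.
have E0 : 0 <= c * ((1 - theta) * h n) by rewrite !mulr_ge0 // ltW.
have E2 : 0 <= theta * h n by rewrite mulr_ge0 // ltW.
rewrite /slab /= /tau /GRing.scale /= mulr1 -/(h n); apply/andP; split.
  by rewrite !addr_ge0.
apply: le_trans tn; have : t n = t n.-1 + h n by rewrite /time_step subrKC.
by move=> ->; lra.
Qed.

Let slab_start n y (c : R) : (0 < n)%N -> t n <= T -> 0 <= c <= 1 ->
  slab T ((tau theta t n, y) + (c * - (theta * h n)) *: @dir_t R N).
Proof.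
move=> n0 tn /andP[c0 c1].
have t0 := grid_time_ge0 ht n.-1; have h0 := step_gt0 ht n0.
have E1 : c * (theta * h n) <= theta * h n.
  by rewrite ler_piMl // mulr_ge0 // ltW.
have E0 : 0 <= c * (theta * h n) by rewrite !mulr_ge0 // ltW.
have E2 : 0 <= (1 - theta) * h n by rewrite mulr_ge0 // ltW.
rewrite /slab /= /tau /GRing.scale /= mulr1 -/(h n); apply/andP; split; first by lra.
apply: le_trans tn; have : t n = t n.-1 + h n by rewrite /time_step subrKC.
by move=> ->; lra.
Qed.

Let step_sq_le n : (0 < n)%N -> h n ^+ 2 <= dt ^+ 2.
Proof.
move=> n0; have h0 := step_gt0 ht n0; have hd := step_le ht n0.
by apply: lerXn2r; rewrite ?nnegrE ?(le_trans (ltW h0) hd) // ltW.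
Qed.

(** The endpoints lie at [(1 - theta) * h] after and [theta * h] before the
    evaluation time; since [(1 - theta) ^+ 2 - theta ^+ 2 = 1 - 2 * theta], the
    second-order terms leave [(1 - 2 * theta) / 2 * h]. *)
Lemma time_difference_error phi n y (T2 T3 : R) : (0 < n)%N -> t n <= T ->
  smooth phi ->
  (forall z, slab T z -> `|Dt 2 phi z| <= T2) ->
  (forall z, slab T z -> `|Dt 3 phi z| <= T3) ->
  `|(phi (t n, y) - phi (t n.-1, y)) / h n - Dt 1 phi (tau theta t n, y)|
  <= `|1 - 2 * theta| / 2 * T2 * dt + dt ^+ 2 * T3.
Proof.
move=> n0 tn sphi H2 H3; have h0 := step_gt0 ht n0; have hd := step_le ht n0.
set z := (tau theta t n, y).
have sz : slab T z.
  have : 0 <= (0 : R) <= 1 by rewrite lexx ler01.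
  by move=> /(slab_start y n0 tn); rewrite mul0r scale0r addr0.
have HT : 0 <= T3 := le_trans (normr_ge0 _) (H3 z sz).
have a1 : `|- (theta * h n)| = theta * h n.
  by rewrite normrN ger0_norm // mulr_ge0 // ltW.
have a2 : `|(1 - theta) * h n| = (1 - theta) * h n.
  by rewrite ger0_norm // mulr_ge0 // ltW.
have := taylor_direction sphi (fun c c01 => H3 _ (slab_end y n0 tn c01)).
have := taylor_direction sphi (fun c c01 => H3 _ (slab_start y n0 tn c01)).
rewrite -end_point -start_point.
have sum3 (eta : R) (g : nat -> R) : \sum_(m < 3) eta ^+ m / m`!%:R * g m =
   g 0%N + eta * g 1%N + eta ^+ 2 / 2 * g 2.
  rewrite !big_ord_recr big_ord0 /= add0r.
  by rewrite (_ : 0`! = 1)%N // (_ : 1`! = 1)%N // (_ : 2`! = 2)%N // ; field.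
rewrite !(sum3 _ (fun m => iterD (nseq m (@dir_t R N)) phi z)).
rewrite -[iterD (nseq 1 _) _ _]/(Dt 1 phi z) -[iterD (nseq 2 _) _ _]/(Dt 2 phi z).
have := H2 z sz.
move: (iterD (nseq 0 _) _ _) (Dt 2 phi z) (Dt 1 phi z) (phi (t n, y)) (phi (t n.-1, y)).
move=> p0 d2 d1 pe ps d2T; rewrite a1 a2.
set es := _ - _ => Hs; set ee := pe - _ => He.
have -> : (pe - ps) / h n - d1 = (1 - 2 * theta) / 2 * d2 * h n + (ee - es) / h n.
  by rewrite /ee /es; field; rewrite gt_eqF.
apply: (le_trans (ler_normD _ _)); apply: lerD.
  rewrite !normrM normfV (ger0_norm (ltW h0)) (@ger0_norm _ 2) //.
  have m0 : 0 <= `|1 - 2 * theta| / 2 by rewrite divr_ge0.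
  by apply: ler_pM; [exact: mulr_ge0|exact: ltW|exact: ler_wpM2l|exact: hd].
rewrite normrM normfV (gtr0_norm h0) ler_pdivrMr //.
apply: (le_trans (ler_normB _ _)).
apply: (le_trans (lerD He Hs)).
rewrite -mulrDl mulrAC ler_wpM2r //.
apply: (@le_trans _ _ (h n ^+ 3)).
  have : (1 - theta) ^+ 3 + theta ^+ 3 <= 1 by move: th0 th1; nra.
  rewrite !exprMn -mulrDl => H; rewrite -[X in _ <= X]mul1r ler_wpM2r //.
  by rewrite exprn_ge0 // ltW.
by rewrite exprSr; apply: ler_wpM2r; [exact: ltW|exact: step_sq_le].
Qed.

(** The evaluation time is the [theta]-average of the endpoints, so the
    first-order terms cancel. *)
Lemma time_average_error f n y (T2 : R) : (0 < n)%N -> t n <= T -> smooth f ->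
  (forall z, slab T z -> `|Dt 2 f z| <= T2) ->
  `|(1 - theta) * f (t n.-1, y) + theta * f (t n, y) - f (tau theta t n, y)|
  <= dt ^+ 2 * T2.
Proof.
move=> n0 tn sf H2; have h0 := step_gt0 ht n0; have hd := step_le ht n0.
set z := (tau theta t n, y).
have HT : 0 <= T2.
  have : 0 <= (0 : R) <= 1 by rewrite lexx ler01.
  by move=> /(slab_start y n0 tn)/H2; exact: le_trans.
have a1 : `|- (theta * h n)| = theta * h n.
  by rewrite normrN ger0_norm // mulr_ge0 // ltW.
have a2 : `|(1 - theta) * h n| = (1 - theta) * h n.
  by rewrite ger0_norm // mulr_ge0 // ltW.
have := taylor_direction sf (fun c c01 => H2 _ (slab_end y n0 tn c01)).
have := taylor_direction sf (fun c c01 => H2 _ (slab_start y n0 tn c01)).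
rewrite -end_point -start_point.
have sum2 (eta : R) (g : nat -> R) : \sum_(m < 2) eta ^+ m / m`!%:R * g m =
   g 0%N + eta * g 1%N.
  rewrite !big_ord_recr big_ord0 /= add0r.
  by rewrite (_ : 0`! = 1)%N // (_ : 1`! = 1)%N //; field.
rewrite !(sum2 _ (fun m => iterD (nseq m (@dir_t R N)) f z)).
rewrite -[iterD (nseq 0 _) _ _]/(f z).
move: (iterD (nseq 1 _) _ _) (f z) (f (t n, y)) (f (t n.-1, y)).
move=> d1 p0 pe ps; rewrite a1 a2.
set es := _ - _ => Hs; set ee := pe - _ => He.
have -> : (1 - theta) * ps + theta * pe - p0 = (1 - theta) * es + theta * ee.
  by rewrite /ee /es; ring.
apply: (le_trans (ler_normD _ _)); rewrite !normrM (ger0_norm th0) (ger0_norm th1).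
apply: (le_trans (lerD (ler_wpM2l th1 Hs) (ler_wpM2l th0 He))).
rewrite (mulrA (1 - theta)) (mulrA theta (_ ^+ 2)) -mulrDl ler_wpM2r //.
apply: (@le_trans _ _ (h n ^+ 2)); last exact: step_sq_le.
have -> : (1 - theta) * (theta * h n) ^+ 2 + theta * ((1 - theta) * h n) ^+ 2
   = (theta * (1 - theta)) * h n ^+ 2 by ring.
rewrite -[X in _ <= X]mul1r ler_wpM2r ?sqr_ge0 //.
by move: th0 th1; nra.
Qed.

End TimeConsistency.
(** * Consistency in space *)

Section SpaceInclusion.
Context {R : realType} {N : nat}.

Definition space_incl (y : 'rV[R]_N) : (R * 'rV[R]_N)%type := (0, y).

Lemma space_incl_linear : linear space_incl.
Proof. by move=> c u v; congr (_, _); rewrite /= scaler0 addr0. Qed.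

HB.instance Definition _ := GRing.isLinear.Build R 'rV[R]_N
  (R * 'rV[R]_N)%type *:%R space_incl space_incl_linear.

Lemma space_incl_continuous : continuous space_incl.
Proof.
move=> y; apply: differentiable_continuous.
apply: (@differentiable_pair _ _ R^o _ (cst 0) idfun); first exact: differentiable_cst.
by apply: linear_differentiable => v; exact: cvg_id.
Qed.

Lemma slice_point (s : R) (y : 'rV[R]_N) : (s, y) = (s, 0) + space_incl y.
Proof. by congr (_, _); rewrite /= ?addr0 ?add0r. Qed.

Lemma space_incl_sum (y : 'rV[R]_N) : space_incl y = \sum_i y 0 i *: dir_x i.
Proof.
rewrite [y in LHS]row_sum_delta linear_sum /=; apply: eq_bigr => i _.
by rewrite linearZ.
Qed.

Lemma slice_shift (s : R) (x y : 'rV[R]_N) :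
  (s, x + y) = (s, x) + \sum_i y 0 i *: dir_x i.
Proof. by rewrite -space_incl_sum; congr (_, _); rewrite /= addr0. Qed.

Lemma smooth_slice (phi : R * 'rV[R]_N -> R) (s : R) : smooth phi ->
  smooth (fun y => phi (s, y)).
Proof.
move=> sphi; under eq_fun do rewrite slice_point.
exact: (@smooth_affine _ _ _ space_incl (s, 0) phi space_incl_continuous sphi).
Qed.

Lemma Dnorm_slice m (phi : R * 'rV[R]_N -> R) (s : R) y :
  Dnorm (@dir R N) m (fun y => phi (s, y)) y = Dnorm (@dir_x R N) m phi (s, y).
Proof.
rewrite /Dnorm; congr Num.sqrt; apply: eq_bigr => w _; congr (_ ^+ 2).
have -> : (fun y => phi (s, y)) = (fun y => phi ((s, 0) + space_incl y)).
  by apply/funext => v; rewrite -slice_point.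
by rewrite (@iterD_affine _ _ _ space_incl) -slice_point -map_comp.
Qed.

End SpaceInclusion.

Section SchemeOperator.
Context {R : realType} {N P M : nat} {A B : Type}.
Context (E : @coefficients R N P A B) (Y : @displacements R N A B M).
Implicit Types (a : A) (b : B) (phi : R * 'rV[R]_N -> R).

(** With the coefficients frozen at the evaluation point [z], the operator can
    be averaged over the endpoint times through its derivatives, taken at [p]. *)
Definition Lop_at a b phi (z p : R * 'rV[R]_N) : R :=
  \sum_i drift E a b z 0 i * iterD [:: dir_x i] phi p
  + \sum_i \sum_j diffusion E a b z i j * iterD [:: dir_x i; dir_x j] phi p.

Lemma LopE a b phi z : smooth phi -> Lop E a b phi z = Lop_at a b phi z z.
Proof.
move=> sphi; rewrite /Lop /Lop_at addrC /mxtrace; congr (_ + _).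
  by apply: eq_bigr => i _; rewrite mxE.
apply: eq_bigr => i _; rewrite mxE; apply: eq_bigr => j _.
by rewrite [hess _ _ _ _]mxE iterD_swap.
Qed.

(** Both signs in one family, so that the two halves of the moment conditions
    and of [Lk] become single sums. *)
Definition displacement k a b z (l : 'I_M + 'I_M) : 'rV[R]_N :=
  match l with inl i => yplus Y k a b i z | inr i => yminus Y k a b i z end.

Lemma sum_displacement k a b z (F : 'rV[R]_N -> R) :
  \sum_l F (displacement k a b z l) =
  \sum_i (F (yplus Y k a b i z) + F (yminus Y k a b i z)).
Proof. by rewrite big_sumType big_split. Qed.

Lemma Lk_displacement k a b psi z :
  Lk Y k a b psi z =
  (\sum_l (psi (z.2 + displacement k a b z l) - psi z.2)) / (2 * k ^+ 2).
Proof.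
rewrite (sum_displacement k a b z (fun y => psi (z.2 + y) - psi z.2)) mulr_suml.
by apply: eq_bigr => i _; congr (_ / _); ring.
Qed.

(** The derivatives are taken at a time [s] which may differ from that of [z],
    where the coefficients and the displacements are evaluated: the moment
    conditions only involve [z]. The fourth moment with equal indices bounds
    every component of every displacement by [(K + 1) * k], because
    [K <= (K + 1) ^+ 4]. *)
Lemma space_consistency (T : R) : Y1 E Y T ->
  exists2 C0 : R, 0 <= C0 &
  forall k a b z s phi (D : nat -> R), 0 < k <= 1 -> slab T z -> 0 <= s <= T ->
    smooth phi -> (forall m, 0 <= D m) ->
    (forall m (w : m.-tuple 'I_N) p, (0 < m < 5)%N -> slab T p ->
       `|iterD (map (@dir_x R N) w) phi p| <= D m) ->
    `|Lk Y k a b (fun y => phi (s, y)) z - Lop_at a b phi z (s, z.2)|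
    <= C0 * (D 1%N + D 2 + D 3 + D 4) * k ^+ 2.
Proof.
move=> [K0 HY]; pose K := `|K0|; have K_ge0 : 0 <= K by exact: normr_ge0.
pose n : R := N%:R; have n0 : 0 <= n by exact: ler0n.
pose m2 : R := (M + M)%:R; have m20 : 0 <= m2 by exact: ler0n.
pose C0 := n * K + n * (n * K) + n * (n * (n * K)) + m2 * (n * (K + 1)) ^+ 4.
have c1 : 0 <= n * K by exact: mulr_ge0.
have c2 : 0 <= n * (n * K) by exact: mulr_ge0.
have c3 : 0 <= n * (n * (n * K)) by exact: mulr_ge0.
have c4 : 0 <= m2 * (n * (K + 1)) ^+ 4.
  by rewrite mulr_ge0 // exprn_ge0 // mulr_ge0 // addr_ge0.
have C00 : 0 <= C0 by rewrite /C0; lra.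
exists C0 => // k a b z s phi D k01 Tz sT sphi D0 HD.
have /andP[k0 k1] := k01.
have k2 : 0 < k ^+ 2 by exact: exprn_gt0.
have k4 : 0 < k ^+ 4 by exact: exprn_gt0.
have KK : K0 * k ^+ 4 <= K * k ^+ 4 by rewrite ler_wpM2r ?ler_norm // ltW.
have [Y1a Y1b Y1c Y1d] := HY k a b z k01 Tz.
pose y (l : 'I_M + 'I_M) i := displacement k a b z l 0 i.
have h1 i : `|\sum_l y l i - 2 * k ^+ 2 * drift E a b z 0 i| <= K * k ^+ 4.
  apply: le_trans KK; apply: le_trans Y1a.
  rewrite (sum_displacement k a b z (fun v => v 0 i)).
  have := enorm_entry (\sum_i0 (yplus Y k a b i0 z + yminus Y k a b i0 z) -
    (2 * k ^+ 2) *: drift E a b z) 0 i.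
  by rewrite !mxE summxE; under eq_bigr do rewrite mxE.
have h2 i j : `|\sum_l y l i * y l j - 2 * (k ^+ 2 * (sigma E a b z *m (sigma E a b z)^T) i j)| <= K * k ^+ 4.
  apply: le_trans KK; apply: le_trans Y1b; rewrite mulrA.
  rewrite (sum_displacement k a b z (fun v => v 0 i * v 0 j)).
  have := enorm_entry (\sum_i0 ((yplus Y k a b i0 z)^T *m yplus Y k a b i0 z +
      (yminus Y k a b i0 z)^T *m yminus Y k a b i0 z) -
    (2 * k ^+ 2) *: (sigma E a b z *m (sigma E a b z)^T)) i j.
  move: (sigma E a b z *m _) => S1; rewrite !mxE summxE.
  rewrite (eq_bigr (fun i0 => yplus Y k a b i0 z 0 i * yplus Y k a b i0 z 0 j +
     yminus Y k a b i0 z 0 i * yminus Y k a b i0 z 0 j)) //.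
  by move=> l _; rewrite !mxE !big_ord1 !mxE.
have h3 i j h : `|\sum_l y l i * y l j * y l h| <= K * k ^+ 4.
  apply: le_trans KK; apply: le_trans (Y1c i j h).
  by rewrite (sum_displacement k a b z (fun v => v 0 i * v 0 j * v 0 h)).
have h4 l i : `|y l i| <= (K + 1) * k.
  have r0 : 0 <= (K + 1) * k by rewrite mulr_ge0 ?addr_ge0 // ltW.
  rewrite -(@ler_pXn2r _ 4) ?nnegrE //.
  apply: (@le_trans _ _ (K * k ^+ 4)); last first.
    rewrite exprMn ler_wpM2r ?(ltW k4) //.
    have : 1 <= (K + 1) ^+ 3 by rewrite exprn_ege1 // lerDr.
    move=> H; apply: (@le_trans _ _ (K + 1)); first by rewrite lerDl.
    by rewrite exprSr -[X in X <= _]mul1r ler_wpM2r // addr_ge0.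
  apply: le_trans KK; apply: le_trans (ler_norm _) _; apply: le_trans (Y1d i i i i).
  rewrite ger0_norm ?exprn_ge0 //; apply: le_trans (ler_norm _).
  rewrite -(sum_displacement k a b z (fun v => v 0 i * v 0 i * v 0 i * v 0 i)).
  have p4 (c : R) : c * c * c * c = `|c| ^+ 4.
    by rewrite -normrX ger0_norm ?exprn_even_ge0 // !exprS expr0 mulr1 !mulrA.
  under eq_bigr do rewrite p4.
  by rewrite (bigD1 l) //= lerDl; apply: sumr_ge0 => ? _; exact: exprn_ge0.
have Tp : slab T (s, z.2) by [].
have f1 w := HD 1%N w (s, z.2) isT Tp.
have f2 w := HD 2 w (s, z.2) isT Tp.
have f3 w := HD 3 w (s, z.2) isT Tp.
have f4 (w : 4.-tuple 'I_N) (c : R) l : 0 <= c <= 1 ->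
    `|iterD (map (@dir_x R N) w) phi ((s, z.2) + c *: \sum_i y l i *: dir_x i)| <= D 4.
  move=> _; apply: HD => //.
  rewrite -space_incl_sum /slab /= /GRing.scale /= mulr0 addr0 //.
have H := moment_expansion (a := fun i j => k ^+ 2 * (sigma E a b z *m (sigma E a b z)^T) i j)
  sphi (D0 4) h1 h2 h3 h4 f1 f2 f3 f4.
rewrite card_sum card_ord -/n -/m2 in H.
have q0 : 0 < 2 * k ^+ 2 by rewrite mulr_gt0.
have -> : Lk Y k a b (fun y => phi (s, y)) z - Lop_at a b phi z (s, z.2) =
  (\sum_l (phi ((s, z.2) + \sum_i y l i *: dir_x i) - phi (s, z.2))
   - (\sum_i 2 * k ^+ 2 * drift E a b z 0 i * iterD [:: dir_x i] phi (s, z.2)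
     + \sum_i \sum_j k ^+ 2 * (sigma E a b z *m (sigma E a b z)^T) i j *
          iterD [:: dir_x i; dir_x j] phi (s, z.2))) / (2 * k ^+ 2).
  rewrite Lk_displacement mulrBl; congr (_ - _).
    by congr (_ / _); apply: eq_bigr => l _; rewrite slice_shift.
  rewrite mulrDl /Lop_at !mulr_suml; congr (_ + _).
    apply: eq_bigr => i _; move: (iterD _ _ _) => d.
    by rewrite -(mulrA (2 * _)) [RHS]mulrC mulKf ?gt_eqF.
  apply: eq_bigr => i _; rewrite mulr_suml; apply: eq_bigr => j _.
  move: (iterD _ _ _) => d; rewrite /diffusion.
  by move: (sigma E a b z *m _) => S; rewrite mxE; field; rewrite gt_eqF.
rewrite normrM normfV (gtr0_norm q0) ler_pdivrMr //; apply: (le_trans H).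
have [d1 d2 d3 d4] : [/\ 0 <= D 1%N, 0 <= D 2, 0 <= D 3 & 0 <= D 4] by [].
move: (D 1%N) (D 2) (D 3) (D 4) d1 d2 d3 d4 => D1 D2 D3 D4 d1 d2 d3 d4.
have -> : n * (K * k ^+ 4 * D1) + n * (n * (K * k ^+ 4 * D2))
     + n * (n * (n * (K * k ^+ 4 * D3))) + m2 * ((n * ((K + 1) * k)) ^+ 4 * D4)
  = k ^+ 4 * (n * K * D1 + n * (n * K) * D2 + n * (n * (n * K)) * D3
              + m2 * (n * (K + 1)) ^+ 4 * D4) by ring.
have -> : C0 * (D1 + D2 + D3 + D4) * k ^+ 2 * (2 * k ^+ 2) =
  k ^+ 4 * (2 * (C0 * D1 + C0 * D2 + C0 * D3 + C0 * D4)) by ring.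
rewrite ler_pM2l //.
have e1 : n * K * D1 <= C0 * D1 by apply: ler_wpM2r => //; rewrite /C0; lra.
have e2 : n * (n * K) * D2 <= C0 * D2 by apply: ler_wpM2r => //; rewrite /C0; lra.
have e3 : n * (n * (n * K)) * D3 <= C0 * D3 by apply: ler_wpM2r => //; rewrite /C0; lra.
have e4 : m2 * (n * (K + 1)) ^+ 4 * D4 <= C0 * D4.
  by apply: ler_wpM2r => //; rewrite /C0; lra.
have : 0 <= C0 * D1 by exact: mulr_ge0.
have : 0 <= C0 * D2 by exact: mulr_ge0.
have : 0 <= C0 * D3 by exact: mulr_ge0.
have : 0 <= C0 * D4 by exact: mulr_ge0.
move: (C0 * D1) (C0 * D2) (C0 * D3) (C0 * D4) e1 e2 e3 e4; clear; move=> *; lra.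
Qed.

End SchemeOperator.
(** * Truncation error *)

Section InfSupDistance.
Context {R : realType} {A B : Type}.

Lemma inf_sup_dist (H G : A -> B -> R) (c e : R) (a0 : A) (b0 : B) :
  (forall a b, `|G a b| <= c) -> (forall a b, `|H a b - G a b| <= e) ->
  exists h g : R, [/\ inf_sup H = h%:E, inf_sup G = g%:E & `|h - g| <= e].
Proof.
move=> Gc HG.
have Gf := inf_sup_fin a0 b0 Gc.
have Hc a b : `|H a b| <= c + e.
  rewrite -(subrK (G a b) (H a b)) addrC; apply: (le_trans (ler_normD _ _)).
  exact: lerD.
have Hf := inf_sup_fin a0 b0 Hc.
exists (fine (inf_sup H)), (fine (inf_sup G)); rewrite !fineK //; split=> //.
have HG' a b : H a b <= G a b + e.
  by have := HG a b; rewrite ler_norml => /andP[_]; rewrite lerBlDl.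
have GH' a b : G a b <= H a b + e.
  by have := HG a b; rewrite distrC ler_norml => /andP[_]; rewrite lerBlDl.
have := inf_sup_leD HG'; have := inf_sup_leD GH'.
rewrite -(fineK Hf) -(fineK Gf) -!EFinD !lee_fin => le1 le2.
by rewrite ler_norml; apply/andP; split; lra.
Qed.

End InfSupDistance.

Section Truncation.
Context {R : realType} {N P M : nat} {A B : Type}.
Context (E : @coefficients R N P A B) (Y : @displacements R N A B M).
Context (T : R) (T0 : 0 < T).
Implicit Types (a : A) (b : B) (phi : R * 'rV[R]_N -> R).

Lemma adde_le_both (u v w : \bar R) : (0 <= u)%E -> (0 <= v)%E -> (u + v <= w)%E ->
  (u <= w)%E /\ (v <= w)%E.
Proof.
by move=> u0 v0 H; split; apply: le_trans H; [exact: leeDl|exact: leeDr].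
Qed.

Lemma norm0_slab_ge0 (V : Type) (nrm : V -> R) (w : R * 'rV[R]_N -> V) :
  (forall v, 0 <= nrm v) -> (0 <= norm0 nrm (slab T) w)%E.
Proof. by move=> n0; apply: norm0_ge0 => //; exists (0, 0); rewrite /slab /= lexx ltW. Qed.

Lemma coefficient_bounds : bounded_coefficients E T ->
  exists2 Ka : R, 0 <= Ka & forall a b z, slab T z ->
  [/\ forall i j, `|diffusion E a b z i j| <= Ka,
      forall i, `|drift E a b z 0 i| <= Ka,
      `|zeroth E a b z| <= Ka & `|source E a b z| <= Ka].
Proof.
move=> [K0 HK]; pose K := `|K0|; have KP : 0 <= K by exact: normr_ge0.
have HK' a b : (norm0 (@enorm R N P) (slab T) (sigma E a b)
     + norm0 (@enorm R 1 N) (slab T) (drift E a b)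
     + norm0 Num.norm (slab T) (zeroth E a b)
     + norm0 Num.norm (slab T) (source E a b) <= K%:E)%E.
  by apply: le_trans (HK a b) _; rewrite lee_fin ler_norm.
pose Ka := K + P%:R * (K * K).
have p0 : 0 <= P%:R * (K * K) by rewrite !mulr_ge0.
exists Ka; first exact: addr_ge0.
move=> a b z Tz.
have K_le_Ka : K <= Ka by rewrite lerDl.
have n1 := norm0_slab_ge0 (sigma E a b) (@enorm_ge0 R N P).
have n2 := norm0_slab_ge0 (drift E a b) (@enorm_ge0 R 1 N).
have n3 := norm0_slab_ge0 (zeroth E a b) (@normr_ge0 R R).
have n4 := norm0_slab_ge0 (source E a b) (@normr_ge0 R R).
have [H3 b4] := adde_le_both (adde_ge0 (adde_ge0 n1 n2) n3) n4 (HK' a b).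
have [H2 b3] := adde_le_both (adde_ge0 n1 n2) n3 H3.
have [b1 b2] := adde_le_both n1 n2 H2.
split.
- move=> i j; rewrite mxE mxE.
  have sK i' j' : `|sigma E a b z i' j'| <= K.
    by apply: le_trans (enorm_entry _ _ _) _; exact: norm0_bound b1 Tz.
  rewrite normrM ger0_norm ?invr_ge0 //.
  apply: (@le_trans _ _ (P%:R * (K * K))); last by rewrite lerDr.
  rewrite -[X in _ <= X]mul1r; apply: ler_pM => //.
    by rewrite invf_le1 // ler1n.
  apply: (le_trans (ler_norm_sum _ _ _)).
  rewrite mulr_natl -[P in X in _ <= X]card_ord -sumr_const; apply: ler_sum => l _.
  by rewrite mxE normrM ler_pM.
- move=> i; apply: le_trans (enorm_entry _ _ _) _; apply: le_trans K_le_Ka.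
  exact: norm0_bound b2 Tz.
- by apply: le_trans K_le_Ka; exact: norm0_bound b3 Tz.
- by apply: le_trans K_le_Ka; exact: norm0_bound b4 Tz.
Qed.

Lemma average_norm_le (s u v m : R) : 0 <= s -> 0 <= 1 - s ->
  `|u| <= m -> `|v| <= m -> `|(1 - s) * u + s * v| <= m.
Proof.
move=> s0 s1 um vm; apply: (le_trans (ler_normD _ _)).
rewrite !normrM (ger0_norm s0) (ger0_norm s1).
apply: (le_trans (lerD (ler_wpM2l s1 um) (ler_wpM2l s0 vm))).
by rewrite -mulrDl subrK mul1r.
Qed.

Lemma Lk_comb k a b (psi psi' : 'rV[R]_N -> R) (s r : R) p :
  Lk Y k a b (fun y => s * psi y + r * psi' y) p =
  s * Lk Y k a b psi p + r * Lk Y k a b psi' p.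
Proof.
rewrite /Lk !mulr_sumr -big_split /=; apply: eq_bigr => i _.
by rewrite !mulrA -mulrDl; congr (_ / _); ring.
Qed.

Lemma Lk_norm_le k a b (psi : 'rV[R]_N -> R) (m : R) p : 0 < k <= 1 ->
  (forall y, `|psi y| <= m) -> `|Lk Y k a b psi p| <= 2 * M%:R * (m / k ^+ 2).
Proof.
move=> k01 pm; rewrite Lk_neighbour_mean //.
apply: (le_trans (ler_normB _ _)).
have -> : 2 * M%:R * (m / k ^+ 2) = M%:R / k ^+ 2 * m + M%:R / k ^+ 2 * m by ring.
apply: lerD; first exact: neighbour_mean_norm_le.
rewrite normrM ger0_norm ?divr_ge0 ?sqr_ge0 //.
by rewrite ler_wpM2l // divr_ge0 ?sqr_ge0.
Qed.

Lemma Lop_at_norm_le a b z (p1 : 'I_N -> R) (p2 : 'I_N -> 'I_N -> R) (Ka c1 c2 : R) :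
  (forall i j, `|diffusion E a b z i j| <= Ka) ->
  (forall i, `|drift E a b z 0 i| <= Ka) ->
  (forall i, `|p1 i| <= c1) -> (forall i j, `|p2 i j| <= c2) ->
  `|\sum_i drift E a b z 0 i * p1 i + \sum_i \sum_j diffusion E a b z i j * p2 i j|
  <= N%:R * (Ka * c1) + N%:R * (N%:R * (Ka * c2)).
Proof.
move=> Ha Hb H1 H2.
have sumB (F : 'I_N -> R) (c : R) : (forall i, `|F i| <= c) -> `|\sum_i F i| <= N%:R * c.
  move=> Fc; apply: (le_trans (ler_norm_sum _ _ _)).
  rewrite mulr_natl -[N in X in _ <= X]card_ord -sumr_const.
  by apply: ler_sum.
apply: (le_trans (ler_normD _ _)); apply: lerD.
  by apply: (sumB) => i; rewrite normrM ler_pM.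
by apply: (sumB) => i; apply: (sumB) => j; rewrite normrM ler_pM.
Qed.

Context (theta dt dx k : R) (t : nat -> R) (x : R -> nat -> 'rV[R]_N).
Context (I : R -> (nat -> R) -> 'rV[R]_N -> R).
Context (htheta : 0 <= theta <= 1) (k01 : 0 < k <= 1).
Context (ht : time_grid dt t).
Context (phi : R * 'rV[R]_N -> R) (sphi : smooth phi).
Context (D : nat -> R).
Context (HD : forall m (w : m.-tuple 'I_N) p, (0 < m < 5)%N -> slab T p ->
   `|iterD (map (@dir_x R N) w) phi p| <= D m).
Context (T2 T3 T21 T22 eta Ka C0 : R).
Context (HT2 : forall z, slab T z -> `|Dt 2 phi z| <= T2).
Context (HT3 : forall z, slab T z -> `|Dt 3 phi z| <= T3).
Context (HT21 : forall i z, slab T z -> `|iterD [:: dir_x i] (Dt 2 phi) z| <= T21).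
Context (HT22 : forall i j z, slab T z ->
   `|iterD [:: dir_x i; dir_x j] (Dt 2 phi) z| <= T22).
Context (Heta : forall n y, t n <= T ->
   `|I dx (fun i => phi (t n, x dx i)) y - phi (t n, y)| <= eta).
Context (HKa : forall a b z, slab T z ->
  [/\ forall i j, `|diffusion E a b z i j| <= Ka,
      forall i, `|drift E a b z 0 i| <= Ka,
      `|zeroth E a b z| <= Ka & `|source E a b z| <= Ka]).
Context (HC0 : forall a b z s, slab T z -> 0 <= s <= T ->
    `|Lk Y k a b (fun y => phi (s, y)) z - Lop_at E a b phi z (s, z.2)|
    <= C0 * (D 1%N + D 2 + D 3 + D 4) * k ^+ 2).

Let U := grid_restr t (x dx) phi.

(** In order: interpolation, difference quotient in space, averaging in time of
    the derivatives, averaging in time of the zeroth order term. *)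
Definition hamiltonian_error : R :=
  2 * M%:R * (eta / k ^+ 2) + C0 * (D 1%N + D 2 + D 3 + D 4) * k ^+ 2
  + (N%:R * (Ka * (dt ^+ 2 * T21)) + N%:R * (N%:R * (Ka * (dt ^+ 2 * T22))))
  + Ka * (dt ^+ 2 * T2).

(** [Lk] is linear, so the interpolation error [err] splits off, and the
    remaining two terms are compared first with the differential operator at
    the two endpoint times and then with the one at the evaluation time. *)
Lemma hamiltonian_consistency n i a b : (0 < n)%N -> t n <= T ->
  `|hamiltonian E Y theta dx k t x I U n i a b
    - (Lop E a b phi (tau theta t n, x dx i)
       + zeroth E a b (tau theta t n, x dx i) * phi (tau theta t n, x dx i)
       + source E a b (tau theta t n, x dx i))|
  <= hamiltonian_error.
Proof.
move=> n0 tn; set z := (tau theta t n, x dx i).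
have [th0 th1] : 0 <= theta /\ 0 <= 1 - theta.
  by case/andP: htheta => ? ?; rewrite subr_ge0.
have Tz : slab T z := tau_slab htheta ht _ n0 tn.
have [aKa bKa cKa fKa] := HKa a b Tz.
have tn' : t n.-1 <= T.
  by apply: le_trans tn; rewrite -subr_ge0 ltW // (step_gt0 ht n0).
have s0 : 0 <= t n.-1 <= T by rewrite (grid_time_ge0 ht) tn'.
have s1 : 0 <= t n <= T by rewrite (grid_time_ge0 ht) tn.
pose err y := (1 - theta) * (I dx (U n.-1) y - phi (t n.-1, y))
   + theta * (I dx (U n) y - phi (t n, y)).
have errB y : `|err y| <= eta.
  by apply: average_norm_le => //; exact: Heta.
have LkE : Lk Y k a b (fun y => (1 - theta) * I dx (U n.-1) y + theta * I dx (U n) y) z =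
   Lk Y k a b err z + ((1 - theta) * Lk Y k a b (fun y => phi (t n.-1, y)) z
     + theta * Lk Y k a b (fun y => phi (t n, y)) z).
  rewrite -Lk_comb -[Lk _ _ _ _ err _]mul1r -[X in _ = _ + X]mul1r -Lk_comb.
  by congr (Lk _ _ _ _ _ _); apply/funext => y; rewrite /err; ring.
have b1 : `|Lk Y k a b err z| <= 2 * M%:R * (eta / k ^+ 2) by exact: Lk_norm_le.
pose L s := Lop_at E a b phi z (s, x dx i).
have b2 : `|(1 - theta) * (Lk Y k a b (fun y => phi (t n.-1, y)) z - L (t n.-1))
   + theta * (Lk Y k a b (fun y => phi (t n, y)) z - L (t n))|
   <= C0 * (D 1%N + D 2 + D 3 + D 4) * k ^+ 2.
  by apply: average_norm_le => //; exact: HC0.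
have commute w : Dt 2 (iterD w phi) = iterD w (Dt 2 phi).
  rewrite /Dt -!iterD_cat; apply: iterD_perm => //.
  by rewrite perm_catC.
have b3 : `|(1 - theta) * L (t n.-1) + theta * L (t n) - Lop_at E a b phi z z|
   <= N%:R * (Ka * (dt ^+ 2 * T21)) + N%:R * (N%:R * (Ka * (dt ^+ 2 * T22))).
  pose avg w := (1 - theta) * iterD w phi (t n.-1, x dx i)
     + theta * iterD w phi (t n, x dx i) - iterD w phi z.
  have -> : (1 - theta) * L (t n.-1) + theta * L (t n) - Lop_at E a b phi z z =
     \sum_i0 drift E a b z 0 i0 * avg [:: dir_x i0] +
     \sum_i0 \sum_j diffusion E a b z i0 j * avg [:: dir_x i0; dir_x j].
    have avg_sum (F G H : 'I_N -> R) : (1 - theta) * (\sum_l F l)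
        + theta * (\sum_l G l) - \sum_l H l =
        \sum_l ((1 - theta) * F l + theta * G l - H l).
      by rewrite !mulr_sumr -big_split /= -sumrB.
    have avgD (p q r s u v : R) : (1 - theta) * (p + q) + theta * (r + s) - (u + v) =
        ((1 - theta) * p + theta * r - u) + ((1 - theta) * q + theta * s - v) by ring.
    have avgM (d p q r : R) : (1 - theta) * (d * p) + theta * (d * q) - d * r =
        d * ((1 - theta) * p + theta * q - r) by ring.
    rewrite /L /Lop_at avgD !avg_sum; congr (_ + _); apply: eq_bigr => l _.
      exact: avgM.
    by rewrite avg_sum; apply: eq_bigr => j _; exact: avgM.
  have avgB w (c : R) : (forall z, slab T z -> `|iterD w (Dt 2 phi) z| <= c) ->
      `|avg w| <= dt ^+ 2 * c.
    move=> Hc; apply: (time_average_error htheta ht (x dx i) n0 tn (smooth_iterD w sphi)).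
    by move=> z' Tz'; rewrite commute; exact: Hc.
  apply: Lop_at_norm_le => //.
  - by move=> l; apply: avgB => z'; exact: HT21.
  - by move=> l j; apply: avgB => z'; exact: HT22.
have b4 : `|zeroth E a b z * ((1 - theta) * U n.-1 i + theta * U n i - phi z)|
   <= Ka * (dt ^+ 2 * T2).
  rewrite normrM ler_pM //.
  exact: (time_average_error htheta ht (x dx i) n0 tn sphi).
rewrite LopE // /hamiltonian LkE -/z.
rewrite (_ : _ - _ = Lk Y k a b err z
   + ((1 - theta) * (Lk Y k a b (fun y => phi (t n.-1, y)) z - L (t n.-1))
      + theta * (Lk Y k a b (fun y => phi (t n, y)) z - L (t n)))
   + ((1 - theta) * L (t n.-1) + theta * L (t n) - Lop_at E a b phi z z)
   + zeroth E a b z * ((1 - theta) * U n.-1 i + theta * U n i - phi z)); last first.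
  move: (Lk _ _ _ _ _ _) (Lk _ _ _ _ _ _) (Lk _ _ _ _ _ _) (L _) (L _) (Lop_at _ _ _ _ _ _).
  move: (zeroth _ _ _ _) (source _ _ _ _) (U _ _) (U _ _) (phi _) => *; ring.
apply: (le_trans (ler_normD _ _)); apply: lerD b4.
apply: (le_trans (ler_normD _ _)); apply: lerD b3.
by apply: (le_trans (ler_normD _ _)); apply: lerD b1 b2.
Qed.

Lemma truncation_error_bound (a0 : A) (b0 : B) :
  (truncation_error E Y theta k t (x dx) (I dx) T phi <=
   (`|1 - 2 * theta| / 2 * T2 * dt + dt ^+ 2 * T3 + hamiltonian_error)%:E)%E.
Proof.
apply: ge_ereal_sup => _ [[n i] [/= n0 tn] <-].
set z := (tau theta t n, x dx i).
have Tz : slab T z := tau_slab htheta ht _ n0 tn.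
pose G a b := Lop E a b phi z + zeroth E a b z * phi z + source E a b z.
have Gc a b : `|G a b| <= N%:R * (Ka * D 1%N) + N%:R * (N%:R * (Ka * D 2)) + Ka * `|phi z| + Ka.
  have [aKa bKa cKa fKa] := HKa a b Tz.
  rewrite /G LopE //; apply: (le_trans (ler_normD _ _)); apply: lerD => //.
  apply: (le_trans (ler_normD _ _)); apply: lerD; last first.
    by rewrite normrM ler_wpM2r.
  apply: Lop_at_norm_le => //.
    by move=> l; exact: (HD [tuple l] isT Tz).
  by move=> l j; exact: (HD [tuple l; j] isT Tz).
have HG a b : `|hamiltonian E Y theta dx k t x I U n i a b - G a b| <= hamiltonian_error.
  exact: hamiltonian_consistency.
have [h [g [Hh Hg hg]]] := inf_sup_dist a0 b0 Gc HG.
rewrite -[scheme_rhs _ _ _ _ _ _ _ _ _ _]/(inf_sup (hamiltonian E Y theta dx k t x I U n i)).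
rewrite -[pde_rhs _ _ _]/(inf_sup G) Hh Hg -!EFinB abse_EFin lee_fin.
have -> : delta_t t U n i - h - (Dt 1 phi z - g) = (delta_t t U n i - Dt 1 phi z) - (h - g) by ring.
apply: (le_trans (ler_normB _ _)); apply: lerD hg.
exact: (time_difference_error htheta ht (x dx i) n0 tn sphi HT2 HT3).
Qed.

End Truncation.
Section Consistent.
Context {R : realType} {N P M : nat} {A B : pointedType}.
Context (E : @coefficients R N P A B) (Y : @displacements R N A B M).
Context (T theta : R) (x : R -> nat -> 'rV[R]_N).
Context (I : R -> (nat -> R) -> 'rV[R]_N -> R) (K : R) (r : nat).
Context (hT : 0 < T) (htheta : 0 <= theta <= 1).
Context (hY1 : Y1 E Y T) (hI1 : I1 x I K r).

Lemma interp_slice_error (dx s Dr : R) (phi : R * 'rV[R]_N -> R) y :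
  0 < dx -> smooth phi -> 0 <= s <= T -> (sup_Dx T r phi <= Dr%:E)%E ->
  `|I dx (fun i => phi (s, x dx i)) y - phi (s, y)| <= K * Dr * dx ^+ r.
Proof.
move=> dx0 sphi sT HDr; have [K0 HI] := hI1.
have slice_le : (norm0 Num.norm setT (Dnorm (@dir R N) r (fun y => phi (s, y))) <= Dr%:E)%E.
  apply: norm0_le => v _; rewrite Dnorm_slice; apply: le_trans HDr.
  exact: (norm0_ubound Num.norm (Dnorm (@dir_x R N) r phi)).
have := HI dx (fun y => phi (s, y)) dx0 (smooth_slice s sphi) (le_lt_trans slice_le (ltry _)).
move=> H; apply: (norm0_bound (D := setT) (w := fun y => I dx (fun i => phi (s, x dx i)) y - phi (s, y))) => //.
apply: (le_trans H); rewrite !EFinM lee_wpmul2r ?lee_fin ?exprn_ge0 ?(ltW dx0) //.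
by rewrite lee_wpmul2l // lee_fin.
Qed.

(** Only the supremum of the [r]-th derivatives may be infinite (for [r = 0]),
    and the bound is then trivial; otherwise it is a bound between reals. *)
Lemma error_bound_real (e e2 e3 e21 e22 er : \bar R) (S : nat -> \bar R)
  (c dt C d q q' T2 T3 T21 T22 : R) (D : nat -> R) :
  e2 = T2%:E -> e3 = T3%:E -> e21 = T21%:E -> e22 = T22%:E ->
  (forall m, (0 < m)%N -> S m = (D m)%:E) -> 0 < C -> 0 < q -> (0 <= er)%E ->
  (forall Dr, er = Dr%:E ->
    e <= (c * T2 * dt + C * (d * (T2 + T3 + T21 + T22) + Dr * q
            + (D 1 + D 2 + D 3 + D 4) * q'))%:E)%E ->
  (e <= c%:E * e2 * dt%:E
      + C%:E * (d%:E * (e2 + e3 + e21 + e22) + er * q%:E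
                + (\sum_(1 <= m < 5) S m) * q'%:E))%E.
Proof.
move=> -> -> -> -> SD C0 q0 er0 H.
have -> : (\sum_(1 <= m < 5) S m = (D 1 + D 2 + D 3 + D 4)%:E)%E.
  rewrite (big_ltn (isT : 1 < 5)%N) (big_ltn (isT : 2 < 5)%N) (big_ltn (isT : 3 < 5)%N).
  by rewrite (big_ltn (isT : 4 < 5)%N) big_geq // adde0 !addeA !SD // -!EFinD.
case: er er0 H => [Dr| |] // er0 H; first exact: (H Dr erefl).
rewrite gt0_mulye ?lte_fin // -!EFinD -!EFinM addey // addye //.
by rewrite gt0_muley ?lte_fin // addey // leey.
Qed.

Lemma scheme_consistent : bounded_coefficients E T ->
  exists C : R,
  forall (dt dx k : R) (t : nat -> R) (phi : R * 'rV[R]_N -> R),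
    0 < dt -> 0 < dx -> 0 < k <= 1 -> time_grid dt t ->
    smooth phi -> bounded_derivatives T phi ->
    (truncation_error E Y theta k t (x dx) (I dx) T phi <=
       (`|1 - 2 * theta| / 2)%:E * sup_Dx T 0 (Dt 2 phi) * dt%:E
       + C%:E * ((dt ^+ 2)%:E * (sup_Dx T 0 (Dt 2 phi)
                                 + sup_Dx T 0 (Dt 3 phi)
                                 + sup_Dx T 1 (Dt 2 phi)
                                 + sup_Dx T 2 (Dt 2 phi))
                 + sup_Dx T r phi * (dx ^+ r / k ^+ 2)%:E
                 + (\sum_(1 <= m < 5) sup_Dx T m phi) * (k ^+ 2)%:E))%E.
Proof.
move=> hb.
have [Ka Ka0 HKa] := coefficient_bounds hT hb.
have [C0 C00 HC0] := space_consistency hY1.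
have [K0 _] := hI1.
pose n : R := N%:R; have n0 : 0 <= n by exact: ler0n.
pose mK := 2 * M%:R * K; have mK0 : 0 <= mK by rewrite !mulr_ge0.
have nKa : 0 <= n * Ka by exact: mulr_ge0.
have nnKa : 0 <= n * (n * Ka) by exact: mulr_ge0.
pose C := 1 + C0 + mK + Ka + n * Ka + n * (n * Ka).
have Cgt0 : 0 < C by rewrite /C; lra.
exists C => dt dx k t phi dt0 dx0 k01 ht sphi bphi.
have /andP[k0 _] := k01; have k2 : 0 < k ^+ 2 by exact: exprn_gt0.
have q0 : 0 < dx ^+ r / k ^+ 2 by rewrite divr_gt0 // exprn_gt0.
have fin m w : (0 < m + size w)%N -> sup_Dx T m (iterD w phi) \is a fin_num.
  exact: sup_Dx_fin.
have real_sup m w : (0 < m + size w)%N ->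
    exists2 c : R, 0 <= c & sup_Dx T m (iterD w phi) = c%:E.
  move=> mw; exists (fine (sup_Dx T m (iterD w phi))); last by rewrite fineK ?fin.
  by apply: fine_ge0; exact: sup_Dx_ge0.
have [T2 p2 E2] : exists2 c : R, 0 <= c & sup_Dx T 0 (Dt 2 phi) = c%:E by exact: real_sup.
have [T3 p3 E3] : exists2 c : R, 0 <= c & sup_Dx T 0 (Dt 3 phi) = c%:E by exact: real_sup.
have [T21 p21 E21] : exists2 c : R, 0 <= c & sup_Dx T 1 (Dt 2 phi) = c%:E by exact: real_sup.
have [T22 p22 E22] : exists2 c : R, 0 <= c & sup_Dx T 2 (Dt 2 phi) = c%:E by exact: real_sup.
have fD m : (0 < m)%N -> sup_Dx T m phi \is a fin_num.
  by move=> m0; apply: (fin m [::]); rewrite addn0.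
have D0 m : 0 <= fine (sup_Dx T m phi) by apply: fine_ge0; exact: sup_Dx_ge0.
have DE m : (0 < m)%N -> sup_Dx T m phi = (fine (sup_Dx T m phi))%:E.
  by move=> m0; rewrite fineK ?fD.
apply: (error_bound_real E2 E3 E21 E22 DE Cgt0 q0 (sup_Dx_ge0 _ _ hT)) => Dr ErD.
have Dr0 : 0 <= Dr by rewrite -lee_fin -ErD; exact: sup_Dx_ge0.
pose D m := fine (sup_Dx T m phi).
have HD m (w : m.-tuple 'I_N) p : (0 < m < 5)%N -> slab T p ->
    `|iterD (map (@dir_x R N) w) phi p| <= D m.
  by move=> /andP[m0 _] Tp; apply: (sup_Dx_bound _ Tp); rewrite -DE.
have HT2 z : slab T z -> `|Dt 2 phi z| <= T2.
  by move=> Tz; have := @sup_Dx_bound _ _ T T2 0 (Dt 2 phi) z [tuple] Tz; rewrite E2; exact.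
have HT3 z : slab T z -> `|Dt 3 phi z| <= T3.
  by move=> Tz; have := @sup_Dx_bound _ _ T T3 0 (Dt 3 phi) z [tuple] Tz; rewrite E3; exact.
have HT21 i z : slab T z -> `|iterD [:: dir_x i] (Dt 2 phi) z| <= T21.
  by move=> Tz; have := @sup_Dx_bound _ _ T T21 1 (Dt 2 phi) z [tuple i] Tz; rewrite E21; exact.
have HT22 i j z : slab T z -> `|iterD [:: dir_x i; dir_x j] (Dt 2 phi) z| <= T22.
  by move=> Tz; have := @sup_Dx_bound _ _ T T22 2 (Dt 2 phi) z [tuple i; j] Tz; rewrite E22; exact.
have Heta m y : t m <= T ->
    `|I dx (fun i => phi (t m, x dx i)) y - phi (t m, y)| <= K * Dr * dx ^+ r.
  move=> tm; apply: interp_slice_error => //; first by rewrite (grid_time_ge0 ht).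
  by rewrite ErD.
have HC a b z s : slab T z -> 0 <= s <= T ->
    `|Lk Y k a b (fun y => phi (s, y)) z - Lop_at E a b phi z (s, z.2)|
    <= C0 * (D 1%N + D 2 + D 3 + D 4) * k ^+ 2.
  by move=> Tz sT; apply: HC0 => // m; exact: D0.
apply: (le_trans (truncation_error_bound htheta k01 ht sphi HD HT2 HT3 HT21 HT22 Heta HKa HC point point)).
rewrite lee_fin /hamiltonian_error -/n -!/(D _).
have pD : 0 <= D 1%N + D 2 + D 3 + D 4 by rewrite !addr_ge0 // D0.
move: (D 1%N + _ + _ + _) pD => S S0.
pose u := Dr * (dx ^+ r / k ^+ 2).
have -> : 2 * M%:R * (K * Dr * dx ^+ r / k ^+ 2) = mK * u by rewrite /mK /u; ring.
rewrite -/u -!addrA lerD2l.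
have d0 : 0 <= dt ^+ 2 by exact: sqr_ge0.
have u0 : 0 <= u by rewrite mulr_ge0 // ltW.
have v0 : 0 <= S * k ^+ 2 by rewrite mulr_ge0 // ltW.
have -> : C0 * S * k ^+ 2 = C0 * (S * k ^+ 2) by rewrite mulrA.
move: (S * k ^+ 2) v0 u u0 => v v0 u u0.
have dT2 : 0 <= dt ^+ 2 * T2 by exact: mulr_ge0.
have dT3 : 0 <= dt ^+ 2 * T3 by exact: mulr_ge0.
have dT21 : 0 <= dt ^+ 2 * T21 by exact: mulr_ge0.
have dT22 : 0 <= dt ^+ 2 * T22 by exact: mulr_ge0.
rewrite !mulrDr.
move: (dt ^+ 2 * T2) (dt ^+ 2 * T3) (dt ^+ 2 * T21) (dt ^+ 2 * T22) dT2 dT3 dT21 dT22.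
move=> e2 e3 e21 e22 e20 e30 e210 e220.
have c3 : e3 <= C * e3 by rewrite -[X in X <= _]mul1r ler_wpM2r // /C; lra.
have cu : mK * u <= C * u by rewrite ler_wpM2r // /C; lra.
have cv : C0 * v <= C * v by rewrite ler_wpM2r // /C; lra.
have c21 : n * (Ka * e21) <= C * e21 by rewrite mulrA ler_wpM2r // /C; lra.
have c22 : n * (n * (Ka * e22)) <= C * e22.
  by rewrite (mulrA n Ka) mulrA ler_wpM2r // /C; lra.
have c2 : Ka * e2 <= C * e2 by rewrite ler_wpM2r // /C; lra.
lra.
Qed.

End Consistent.

(** * Stability in the supremum norm *)

Section Stable.
Context {R : realType} {N P M : nat} {A B : pointedType}.
Context (E : @coefficients R N P A B) (Y : @displacements R N A B M).
Context (T theta : R) (x : R -> nat -> 'rV[R]_N).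
Context (I : R -> (nat -> R) -> 'rV[R]_N -> R) (g : 'rV[R]_N -> R).
Context (hT : 0 < T) (hN : (0 < N)%N) (htheta : 0 <= theta <= 1) (hI2 : I2' x I).

Lemma norm0_le_norm1 (Z : Type) (V : zmodType) (dist : Z -> Z -> R) (nrm : V -> R)
    (D : set Z) (w : Z -> V) (p q : Z) :
  D p -> D q -> p <> q -> 0 <= dist p q -> (forall v, 0 <= nrm v) ->
  (0 <= norm0 nrm D w /\ norm0 nrm D w <= norm1 dist nrm D w)%E.
Proof.
move=> Dp Dq pq d0 n0; split; first by apply: norm0_ge0 => //; exists p.
rewrite leeDl //; apply: ereal_sup_ge; exists (nrm (w p - w q) / dist p q)%:E.
  by exists (p, q).
by rewrite lee_fin divr_ge0.
Qed.

(** The seminorms in [norm1] are nonnegative since their index sets are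
    nonempty: this uses [0 < T] and, for [g], [0 < N]. *)
Lemma A1_bounds : A1 E T g -> exists K : R, 0 <= K /\
  [/\ (norm0 Num.norm setT g <= K%:E)%E,
      forall a b, (norm0 Num.norm (slab T) (zeroth E a b) <= K%:E)%E &
      forall a b, (norm0 Num.norm (slab T) (source E a b) <= K%:E)%E].
Proof.
move=> [K HK].
have slab0 : slab T ((0, 0) : R * 'rV[R]_N) by rewrite /slab /= lexx ltW.
have slabT : slab T ((T, 0) : R * 'rV[R]_N) by rewrite /slab /= lexx ltW.
have ne : (0, 0) <> (T, 0) :> R * 'rV[R]_N.
  by move=> /(congr1 fst) /= T0; move: hT; rewrite -T0 ltxx.
have d0 : 0 <= parabolic_dist ((0, 0) : R * 'rV[R]_N) (T, 0).
  by rewrite addr_ge0 ?sqrtr_ge0.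
have ne' : (0 : 'rV[R]_N) <> const_mx 1.
  move=> /rowP /(_ (Ordinal hN)); rewrite !mxE => /eqP.
  by rewrite eq_sym oner_eq0.
have d0' : 0 <= space_dist (0 : 'rV[R]_N) (const_mx 1) by exact: sqrtr_ge0.
have base a b : [/\ (norm0 Num.norm setT g <= K%:E)%E,
   (norm0 Num.norm (slab T) (zeroth E a b) <= K%:E)%E &
   (norm0 Num.norm (slab T) (source E a b) <= K%:E)%E].
  have [g0 gg] := norm0_le_norm1 (D := setT) g (p := 0) (q := const_mx 1) Logic.I Logic.I ne' d0' (@normr_ge0 R R).
  have [s0 ss] := norm0_le_norm1 (sigma E a b) slab0 slabT ne d0 (@enorm_ge0 R N P).
  have [b0 bb] := norm0_le_norm1 (drift E a b) slab0 slabT ne d0 (@enorm_ge0 R 1 N).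
  have [c0 cc] := norm0_le_norm1 (zeroth E a b) slab0 slabT ne d0 (@normr_ge0 R R).
  have [f0 ff] := norm0_le_norm1 (source E a b) slab0 slabT ne d0 (@normr_ge0 R R).
  have H : (norm0 Num.norm setT g + norm0 (@enorm R N P) (slab T) (sigma E a b)
     + norm0 (@enorm R 1 N) (slab T) (drift E a b)
     + norm0 Num.norm (slab T) (zeroth E a b)
     + norm0 Num.norm (slab T) (source E a b) <= K%:E)%E.
    by apply: le_trans (HK a b); rewrite !leeD.
  have [H3 h5] := adde_le_both (adde_ge0 (adde_ge0 (adde_ge0 g0 s0) b0) c0) f0 H.
  have [H2 h4] := adde_le_both (adde_ge0 (adde_ge0 g0 s0) b0) c0 H3.
  have [H1 _] := adde_le_both (adde_ge0 g0 s0) b0 H2.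
  have [h1 _] := adde_le_both g0 s0 H1.
  by split.
have [gK _ _] := base point point.
exists K; split.
  by rewrite -lee_fin; apply: le_trans gK; apply: norm0_ge0 => //; exists 0.
by split=> // a b; have [] := base a b.
Qed.

Lemma sup_AB_bound (H : A -> B -> \bar R) (c : R) :
  (forall a b, 0 <= H a b)%E -> (forall a b, H a b <= c%:E)%E ->
  exists2 s : R, 0 <= s /\ sup_AB H = s%:E & forall a b, (H a b <= s%:E)%E.
Proof.
move=> H0 Hc.
have le a b : (H a b <= sup_AB H)%E by apply: ereal_sup_ubound; exists (a, b).
have s0 : (0 <= sup_AB H)%E := le_trans (H0 point point) (le point point).
have sc : (sup_AB H <= c%:E)%E by apply: ge_ereal_sup => _ [[a b] _ <-]; exact: Hc.
have sf : sup_AB H \is a fin_num by rewrite ge0_fin_numE // (le_lt_trans sc) // ltry.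
exists (fine (sup_AB H)); rewrite fineK //; split=> //; exact: fine_ge0.
Qed.

Lemma scheme_Linfty_stable (dt dx k : R) (t : nat -> R) :
  0 < dx -> 0 < k <= 1 -> time_grid dt t ->
  CFL E M theta k t (x dx) T dt -> A1 E T g ->
  ((2 * theta * dt)%:E * sup_zeroth_pos E T <= 1)%E ->
  forall U : nat -> nat -> R,
    (exists C : R, forall n i, t n <= T -> `|U n i| <= C) ->
    (forall n i, (0 < n)%N -> t n <= T ->
       scheme_eq E Y theta k t (x dx) (I dx) U n i) ->
    (forall i, U 0%N i = g (x dx i)) ->
    forall n, t n <= T ->
      (norm0 Num.norm setT (U n) <=
       expeR (2%:E * sup_zeroth_pos E T * (t n)%:E)
       * (norm0 Num.norm setT g + (t n)%:E * sup_source E T))%E.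
Proof.
move=> dx0 k01 ht hCFL hA1 hstep U Ubd Ueq U0 n tn.
have [K [K0 [gK cK fK]]] := A1_bounds hA1.
have n0 (w : R * 'rV[R]_N -> R) : (0 <= norm0 Num.norm (slab T) w)%E.
  exact: norm0_slab_ge0.
have [c0 [c00 c0E] c0P] : exists2 s : R, 0 <= s /\ sup_zeroth_pos E T = s%:E &
    forall a b, (norm0 Num.norm (slab T) (fun z => Num.max (zeroth E a b z) 0)%R <= s%:E)%E.
  apply: (@sup_AB_bound _ K) => // a b; apply: norm0_le => z Tz; rewrite lee_fin.
  have := norm0_bound (cK a b) Tz; case: (leP (zeroth E a b z) 0) => // _ _.
  by rewrite normr0.
have [f0 [f00 f0E] f0P] : exists2 s : R, 0 <= s /\ sup_source E T = s%:E &
    forall a b, (norm0 Num.norm (slab T) (source E a b) <= s%:E)%E.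
  exact: (@sup_AB_bound _ K).
have g0 : (0 <= norm0 Num.norm setT g)%E by apply: norm0_ge0 => //; exists 0.
have gf : norm0 Num.norm setT g \is a fin_num.
  by rewrite ge0_fin_numE // (le_lt_trans gK) // ltry.
have hc a b p : slab T p -> zeroth E a b p <= c0.
  move=> Tp; have := norm0_bound (c0P a b) Tp; apply: le_trans.
  by apply: le_trans (ler_norm _); rewrite le_max lexx.
have hf a b p : slab T p -> `|source E a b p| <= f0.
  by move=> Tp; exact: norm0_bound (f0P a b) Tp.
have hs : 2 * theta * dt * c0 <= 1 by move: hstep; rewrite c0E -EFinM lee_fin.
have UG i : `|U 0%N i| <= fine (norm0 Num.norm setT g).
  by rewrite U0; apply: (norm0_bound (D := setT)) => //; rewrite fineK.
rewrite c0E f0E -(fineK gf) -!EFinM /=.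
apply: norm0_le => i _; rewrite lee_fin.
exact: (scheme_stable htheta dx0 k01 ht hI2 hCFL point point hc hf c00 hs Ubd Ueq UG tn).
Qed.

End Stable.

Theorem lemma4p1 (R : realType) (N P M : nat) (A B : completeMetricType R)
  (T : R) (E : @coefficients R N P A B) (g : 'rV[R]_N -> R)
  (Y : @displacements R N A B M) (theta rho : R)
  (cell inball : R -> nat -> set 'rV[R]_N) (x : R -> nat -> 'rV[R]_N)
  (I : R -> (nat -> R) -> 'rV[R]_N -> R) (K : R) (r : nat)
  (hT : 0 < T) (hN : (0 < N)%N) (hM : (0 < M)%N)
  (htheta : 0 <= theta <= 1) (hrho : 0 < rho < 1)
  (hmesh : forall dx : R, 0 < dx ->
     mesh_of_size rho dx (cell dx) (inball dx) (x dx))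
  (hY1 : Y1 E Y T) (hI1 : I1 x I K r) (hI2 : I2' x I) :
  (* (a) *)
  (bounded_coefficients E T ->
   exists C : R,
   forall (dt dx k : R) (t : nat -> R) (phi : R * 'rV[R]_N -> R),
     0 < dt -> 0 < dx -> 0 < k <= 1 -> time_grid dt t ->
     smooth phi -> bounded_derivatives T phi ->
     (truncation_error E Y theta k t (x dx) (I dx) T phi <=
        (`|1 - 2 * theta| / 2)%:E * sup_Dx T 0 (Dt 2 phi) * dt%:E
        + C%:E * ((dt ^+ 2)%:E * (sup_Dx T 0 (Dt 2 phi)
                                  + sup_Dx T 0 (Dt 3 phi)
                                  + sup_Dx T 1 (Dt 2 phi)
                                  + sup_Dx T 2 (Dt 2 phi))
                  + sup_Dx T r phi * (dx ^+ r / k ^+ 2)%:E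
                  + (\sum_(1 <= m < 5) sup_Dx T m phi) * (k ^+ 2)%:E))%E)
  /\
  (forall (dt dx k : R) (t : nat -> R),
     0 < dt -> 0 < dx -> 0 < k <= 1 -> time_grid dt t ->
     CFL E M theta k t (x dx) T dt ->
     (* (b) *)
     class_Ltilde A B T t (scheme_eq E Y theta k t (x dx) (I dx))
     /\
     (* (c) *)
     (A1 E T g ->
      ((2 * theta * dt)%:E * sup_zeroth_pos E T <= 1)%E ->
      forall U : nat -> nat -> R,
        (exists C : R, forall n i, t n <= T -> `|U n i| <= C) ->
        (forall n i, (0 < n)%N -> t n <= T ->
           scheme_eq E Y theta k t (x dx) (I dx) U n i) ->
        (forall i, U 0%N i = g (x dx i)) ->
        forall n, t n <= T ->
          (norm0 Num.norm setT (U n) <=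
           expeR (2%:E * sup_zeroth_pos E T * (t n)%:E)
           * (norm0 Num.norm setT g + (t n)%:E * sup_source E T))%E)).
Proof.
split; first exact: (scheme_consistent hT htheta hY1 hI1).
move=> dt dx k t dt0 dx0 k01 ht hCFL; split.
  exact: (scheme_class_Ltilde Y htheta dx0 k01 ht hI2 hCFL).
move=> hA1 hstep.
exact: (scheme_Linfty_stable hT hN htheta hI2 dx0 k01 ht hCFL hA1 hstep).
Qed.
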